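(* There exists a universal constant $c>0$ such that for all integers $m\ge 1$ and $d\ge 2$ the following holds. Let $G$ be the $d$-dimensional grid graph $P_m\square\cdots\square P_m$ ($d$ factors) and let $N=m^d$ be its number of vertices. Then any embedding of the transportation cost space $\mathrm{TC}(G)$ into $L_1$ has bi-Lipschitz distortion at least $c\log N = c\,d\log m$; that is, if $C\ge 1$ and $F:\mathrm{TC}(G)\to L_1(0,1)$ is a (not necessarily linear) map with $\|\mu-\nu\|_{\mathrm{TC}}\le \|F(\mu)-F(\nu)\|_1\le C\|\mu-\nu\|_{\mathrm{TC}}$ for all $\mu,\nu\in \mathrm{TC}(G)$, then $C\ge c\log N$.
   Context: $P_m$ is the path graph on $m$ nodes and $\square$ denotes the graph Cartesian product. Thus $G=(V,E)$ has vertex set $V=\{1,\dots,m\}^d$, with two vertices adjacent iff they differ by $\pm$ a standard basis vector; $d_G$ denotes the (unweighted) shortest path metric on $V$. $\mathrm{TC}(G)$ is the Banach space of real signed measures $\mu$ on $V$ with $\mu(V)=0$, equipped with the transportation cost norm: $\|\mu\|_{\mathrm{TC}}$ is the infimum of $\sum_{i} a_i d_G(x_i,y_i)$ over all finite representations $\mu=\sum_i a_i(\delta_{x_i}-\delta_{y_i})$ with $a_i\ge 0$, $x_i,y_i\in V$. Equivalently, its unit ball is $\mathrm{conv}\{(\delta_x-\delta_y)/d_G(x,y): x,y\in V, x\neq y\}$. *)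

(* Defs.v *)
From HB Require Import structures.
From mathcomp Require Import all_boot all_order all_algebra.
From mathcomp Require Import all_classical all_reals all_analysis.
From mathcomp Require Import measurable_realfun.

Set Implicit Arguments.
Unset Strict Implicit.
Unset Printing Implicit Defensive.

Import Order.TTheory GRing.Theory Num.Theory.
Import numFieldNormedType.Exports.

Local Open Scope classical_set_scope.
Local Open Scope ring_scope.

Definition path_graph (m : nat) : rel 'I_m :=
  [rel a b : 'I_m | (a.+1 == b :> nat) || (b.+1 == a :> nat)].

Definition cartesian_power (V : finType) (e : rel V) (d : nat) :
    rel {ffun 'I_d -> V} :=
  [rel x y : {ffun 'I_d -> V} | [exists i, e (x i) (y i)
                        && [forall j, (j != i) ==> (x j == y j)]]].

Definition grid (m d : nat) : finType := {ffun 'I_d -> 'I_m}.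

Definition grid_graph (m d : nat) : rel (grid m d) :=
  cartesian_power (@path_graph m) (d := d).

(* [path e x p] describes a walk with [size p] edges starting at [x].  The
   infimum is the junk value 0 for vertices in different components. *)
Definition graph_dist (R : realType) (V : finType) (e : rel V) (x y : V) : R :=
  inf [set r | exists p : seq V,
    [/\ path e x p, last x p = y & r = (size p)%:R]].

(* On a finite set, signed measures are given by their values on singletons. *)
Definition balanced (R : realType) (V : finType) : {pred {ffun V -> R}} :=
  fun mu => \sum_v mu v == 0.

Record TC (R : realType) (V : finType) (e : rel V) : Type := MkTC {
  mass :> {ffun V -> R};
  _ : mass \in @balanced R V
}.

Section TCLmodule.
Variables (R : realType) (V : finType) (e : rel V).

HB.instance Definition _ := [isSub for @mass R V e].
HB.instance Definition _ := [Choice of TC R e by <:].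

Lemma balanced_submod_closed : submod_closed (@balanced R V).
Proof.
split=> [|a mu nu]; rewrite !unfold_in.
  by apply/eqP/big1 => v _; rewrite ffunE.
move=> /eqP mu0 /eqP nu0; under eq_bigr do rewrite !ffunE.
by rewrite big_split/= -scaler_sumr mu0 nu0 scaler0 addr0.
Qed.

HB.instance Definition _ :=
  GRing.isSubmodClosed.Build R {ffun V -> R} (@balanced R V) balanced_submod_closed.
HB.instance Definition _ :=
  [SubChoice_isSubLmodule of TC R e by <:].

End TCLmodule.

Definition point_mass (R : realType) (V : finType) (x : V) : {ffun V -> R} :=
  [ffun v => (v == x)%:R].

Definition TC_norm (R : realType) (V : finType) (e : rel V) (mu : TC R e) : R :=
  inf [set r | exists (n : nat) (a : 'I_n -> R) (x y : 'I_n -> V),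
    [/\ forall i, 0 <= a i,
        mass mu = \sum_i a i *: (point_mass R (x i) - point_mass R (y i)) &
        r = \sum_i a i * graph_dist R e (x i) (y i)]].

Definition lebesgue01 (R : realType) :
    {measure set (measurableTypeR R) -> \bar R} :=
  mrestr lebesgue_measure (measurable_itv `]0%R, 1%R[).

Definition L1_01 (R : realType) : Type := LspaceType1 (lebesgue01 R).

(* Elements of the library's [L^1] are almost everywhere classes, coerced to
   functions by choosing a representative; the norm below does not depend on
   that choice. *)
Definition L1_dist (R : realType) (f g : L1_01 R) : \bar R :=
  'N[lebesgue01 R]_1[EFin \o ((f : R -> R) \- (g : R -> R))%R]%E.

(* Main.v *)
Require Import Defs.
From HB Require Import structures.
From mathcomp Require Import all_boot all_order all_algebra.
From mathcomp Require Import all_classical all_reals all_analysis.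
From mathcomp Require Import measurable_realfun.
From mathcomp Require Import ring lra zify.

Set Implicit Arguments.
Unset Strict Implicit.
Unset Printing Implicit Defensive.

Import Order.TTheory GRing.Theory Num.Theory.
Import numFieldNormedType.Exports.

Local Open Scope classical_set_scope.
Local Open Scope ring_scope.

(** Suppose that measures [s i] of total mass zero, weights [c i >= 0] and a
    constant [p] satisfy, for every real function [f] on the vertices, the
    Poincare inequality

      sum_i c_i |<s_i, f>| <= p * sum over edges xy of |f x - f y|.

    A linear map from TC(G) to L1 is a family of such functions [f], one for
    each point of the measure space.  Integrating over that space, and using
    that an edge has length 1, one gets sum_i c_i |s_i|_TC <= p C #edges for
    every linear map of distortion C.  Measures that are expensive to transport,
    although no [f] of small variation sees them, thus force C to be large
    ([distortion_ge]); transport costs are bounded from below by pairing with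
    1-Lipschitz functions ([le_TC_norm]).

    A nonlinear map F is linearized at large scale.  Averaging F over L steps
    in each of the directions delta_x - delta_o changes it by O(L), while its
    unit increments in these directions now vary only by O(1/L) under bounded
    translations; up to O(1/L), the increment along an integer measure is then
    a linear function of its coefficients.  The lower bound for F concerns long
    segments only.  It is passed on to unit increments at a single random base
    point, spread over M steps along each [s i], so that a telescoping sum is
    available for all [i] at once ([linearized_poincare], with M = L^2).

    By the layer cake formula the Poincare inequality is needed only for
    indicators of sets S of at most half of the vertices ([layer_cake],
    [grid_distortion_ge]), where the right hand side is the edge boundary.  Its
    lower bound comes from an additive Loomis-Whitney inequality: each line
    that meets S without being contained in it crosses the boundary
    ([loomis_whitney], [isoperimetric]).

    In dimension d >= 3, [s] is the empirical measure of n = 2^j random points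
    minus the uniform measure.  Moving it costs about n d K with the typical
    spacing K = m q^(-j), q = 2^(1/d), because small l1 balls around n points
    miss half of the grid ([small_ball], [sum_sample_dist_ge]).  If S has density
    about 2^(-l), the normalized discrepancy of S is of the order of the density
    for j < l and decays geometrically in j - l afterwards, by the second moment.
    Weighting the scale j by 1/K makes all scales contribute the same to the
    transport cost, while the discrepancies sum up to a multiple of the
    perimeter ([dyadic_sum]).  There are about log N scales.

    In the plane independent points fluctuate too much: a half plane would be
    seen equally by all scales.  There [s] is a combination with random signs of
    Haar functions on squares of side K, a power of 2; only squares that meet the
    boundary of S contribute, so the discrepancy decays on both sides of the scale given
    by the perimeter ([planar_scale_term]). *)

(** * Smoothing by averages over translates *)

Definition translate_avg (R : realType) (X : zmodType) (W : lmodType R)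
    (L : nat) (u : X) (H : X -> W) : X -> W :=
  fun mu => L%:R^-1 *: \sum_(k < L) H (mu + u *+ k).

Lemma sum_ord_le (R : numDomainType) L (f : 'I_L -> R) c :
  (forall k, f k <= c) -> \sum_(k < L) f k <= L%:R * c.
Proof.
move=> h; rewrite mulr_natl -[X in c *+ X]card_ord -sumr_const.
by apply: ler_sum => k _; exact: h.
Qed.

Section Differencing.
Variables (R : realType) (X : zmodType) (W : lmodType R) (nn : W -> R).
Hypothesis nnD : forall a b, nn (a + b) <= nn a + nn b.
Hypothesis nnZ : forall (k : R) a, nn (k *: a) = `|k| * nn a.

Lemma seminorm0 : nn 0 = 0.
Proof. by rewrite -(scale0r 0) nnZ normr0 mul0r. Qed.

Lemma seminormN a : nn (- a) = nn a.
Proof. by rewrite -scaleN1r nnZ normrN1 mul1r. Qed.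

Lemma seminormB a b : nn (a - b) <= nn a + nn b.
Proof. by rewrite -[nn b]seminormN; exact: nnD. Qed.

Lemma seminorm_sum (I : Type) (r : seq I) (P : pred I) (f : I -> W) :
  nn (\sum_(i <- r | P i) f i) <= \sum_(i <- r | P i) nn (f i).
Proof.
elim/big_rec2: _ => [|i y x _ h]; first by rewrite seminorm0.
by apply: (le_trans (nnD _ _)); rewrite lerD2l.
Qed.

Definition difference (u : X) (H : X -> W) : X -> W :=
  fun mu => H (mu + u) - H mu.

Definition osc (v : X) (c : R) (H : X -> W) : Prop :=
  forall mu, nn (difference v H mu) <= c.

Lemma difference_translate_avg L u v (H : X -> W) :
  difference v (translate_avg L u H) = translate_avg L u (difference v H).
Proof.
apply/funext => mu; rewrite /difference /translate_avg -scalerBr -sumrB.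
by congr (_ *: _); apply: eq_bigr => k _; rewrite addrAC.
Qed.

Lemma nn_translate_avg L u (H : X -> W) c : (0 < L)%N ->
  (forall mu, nn (H mu) <= c) -> forall mu, nn (translate_avg L u H mu) <= c.
Proof.
move=> L0 h mu; rewrite /translate_avg nnZ normfV normr_nat ler_pdivrMl ?ltr0n//.
apply: (le_trans (seminorm_sum _ _ _)).
by apply: sum_ord_le => k; exact: h.
Qed.

Lemma osc_translate_avg L u v (H : X -> W) c : (0 < L)%N ->
  osc v c H -> osc v c (translate_avg L u H).
Proof.
by move=> L0 h mu; rewrite difference_translate_avg; exact: nn_translate_avg.
Qed.

Lemma difference_translate_avg_diag L u (H : X -> W) mu :
  difference u (translate_avg L u H) mu = L%:R^-1 *: (H (mu + u *+ L) - H mu).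
Proof.
rewrite /difference /translate_avg -scalerBr; congr (_ *: _).
pose f k := H (mu + u *+ k).
transitivity (\sum_(0 <= k < L) (f k.+1 - f k)).
  rewrite -sumrB big_mkord; apply: eq_bigr => k _.
  by rewrite /f mulrS addrA addrAC.
by rewrite telescope_sumr// /f mulr0n addr0.
Qed.

(** The increment of an average over [L] steps in its own direction telescopes
    to an increment over [L] steps, divided by [L]. *)
Lemma osc_difference_translate_avg L u v (H : X -> W) c : (0 < L)%N ->
  osc v c H -> osc v (2 * c / L%:R) (difference u (translate_avg L u H)).
Proof.
move=> L0 h mu; rewrite {1}/difference !difference_translate_avg_diag.
rewrite -scalerBr nnZ normfV normr_nat mulrC ler_pM2r ?invr_gt0 ?ltr0n//.
set a := H _; set b := H _; set a' := H _; set b' := H _.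
rewrite (_ : a - b - (a' - b') = (a - a') - (b - b')); last first.
  by rewrite !opprD !opprK addrACA.
apply: (le_trans (seminormB _ _)); rewrite mulr_natl mulr2n lerD//.
  by rewrite /a /a' addrAC; exact: h.
exact: h.
Qed.

(** Each property below is preserved by every average, and holds from the moment
    the relevant direction has been averaged over; hence no two averages ever
    need to be exchanged. *)
Definition smooth L (us : seq X) (H : X -> W) : X -> W :=
  foldr (translate_avg L) H us.

Lemma osc_smooth L us v (H : X -> W) c : (0 < L)%N ->
  osc v c H -> osc v c (smooth L us H).
Proof. by move=> L0 h; elim: us => //= u us ih; exact: osc_translate_avg. Qed.

Lemma osc_difference_smooth L us u v (H : X -> W) c : (0 < L)%N -> u \in us ->
  osc v c H -> osc v (2 * c / L%:R) (difference u (smooth L us H)).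
Proof.
move=> L0 + h; elim: us => //= w us ih; rewrite inE => /orP[/eqP <-|/ih hu].
  by apply: osc_difference_translate_avg => //; exact: osc_smooth.
by rewrite difference_translate_avg; exact: osc_translate_avg.
Qed.

Lemma osc_muln v (H : X -> W) c k : osc v c H -> osc (v *+ k) (c *+ k) H.
Proof.
move=> h; elim: k => [|k ih] mu.
  by rewrite /difference !mulr0n addr0 subrr seminorm0.
rewrite /difference !mulrS [v + _]addrC addrA.
rewrite -(subrKA (H (mu + v *+ k))) -[X in nn (X + _)]/(difference v H (mu + v *+ k)).
by apply: (le_trans (nnD _ _)); rewrite lerD //; exact: ih.
Qed.

Lemma smooth_close L us (H : X -> W) c : (0 < L)%N -> 0 <= c ->
  (forall u, u \in us -> osc u c H) ->
  forall mu, nn (smooth L us H mu - H mu) <= c * L%:R * (size us)%:R.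
Proof.
move=> L0 c0; elim: us => [_ mu|u us ih h mu] /=.
  by rewrite subrr seminorm0 mulr0.
set G := smooth L us H.
rewrite -(subrKA (G mu)); apply: (le_trans (nnD _ _)).
rewrite mulrS mulrDr mulr1 lerD//; last first.
  by apply: ih => v vus; apply: h; rewrite inE vus orbT.
have -> : translate_avg L u G mu - G mu =
    translate_avg L u (fun nu => G nu - G mu) mu.
  rewrite /translate_avg big_split/= sumr_const card_ord scalerDr; congr (_ + _).
  by rewrite -[- G mu *+ L]scaler_nat scalerA mulVf ?scale1r// pnatr_eq0 -lt0n.
rewrite /translate_avg nnZ normfV normr_nat ler_pdivrMl ?ltr0n//.
apply: (le_trans (seminorm_sum _ _ _)).
apply: sum_ord_le => k.
have /(osc_muln k)/(_ mu) : osc u c G.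
  by apply: osc_smooth => //; apply: h; rewrite inE eqxx.
move=> /le_trans; apply; rewrite -[c *+ k]mulr_natr ler_wpM2l// ler_nat.
by apply/ltnW.
Qed.

End Differencing.


(** * Linearization of Lipschitz maps *)
Section ScalarAveraging.
Variables (R : realType) (X : zmodType).
Implicit Types h : X -> R^o.

Lemma smooth_le M us h (U : R) : (0 < M)%N ->
  (forall mu, h mu <= U) -> forall mu, smooth M us h mu <= U.
Proof.
move=> M0 hU; elim: us => //= u us ih mu.
rewrite /translate_avg /GRing.scale/= ler_pdivrMl ?ltr0n//.
by apply: sum_ord_le => k; exact: ih.
Qed.

Lemma smooth_sum M us (I : finType) (c : I -> R) (g : I -> X -> R^o) mu :
  smooth M us (fun nu => \sum_i c i * g i nu : R^o) mu =
  \sum_i c i * smooth M us (g i) mu.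
Proof.
elim: us mu => //= u us ih mu.
rewrite /translate_avg /GRing.scale/=.
under eq_bigr do rewrite ih.
rewrite exchange_big/= mulr_sumr; apply: eq_bigr => i _.
by rewrite -mulr_sumr mulrCA.
Qed.

(** Once [h] has been averaged in the direction [v], the lower bound for sums
    along segments holds pointwise.  For a list of directions this produces lower
    bounds, valid at a common base point, from estimates that each involve
    only segments in one direction. *)
Lemma smooth_ge M us v h (B : R) : (0 < M)%N -> v \in us ->
  (forall mu, B <= \sum_(k < M) h (mu + v *+ k)) ->
  forall mu, B / M%:R <= smooth M us h mu.
Proof.
move=> M0.
have low w (f : X -> R^o) (b : R) : (forall nu, b <= f nu) ->
    forall nu, b <= translate_avg M w f nu.
  move=> hf nu; rewrite /translate_avg /GRing.scale/= ler_pdivlMl ?ltr0n//.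
  rewrite mulr_natl -[X in _ *+ X]card_ord -sumr_const.
  by apply: ler_sum => k _; exact: hf.
move=> + hB; elim: us => //= w us ih; rewrite inE => /orP[/eqP <-|/ih hu]; last first.
  exact: low.
move=> mu; rewrite /translate_avg /GRing.scale/= mulrC ler_pM2l ?invr_gt0 ?ltr0n//.
elim: us mu {ih} => //= u us ih mu; rewrite /translate_avg /GRing.scale/=.
rewrite -mulr_sumr exchange_big/= ler_pdivlMl ?ltr0n//.
rewrite mulr_natl -[X in _ *+ X]card_ord -sumr_const.
apply: ler_sum => k _; apply: le_trans (ih (mu + u *+ k)) _.
by apply: ler_sum => l _; rewrite addrAC.
Qed.
End ScalarAveraging.

Section Transfer.
Variables (R : realType) (X : zmodType) (W : lmodType R) (nn : W -> R).
Hypothesis nnD : forall a b, nn (a + b) <= nn a + nn b.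
Hypothesis nnZ : forall (k : R) a, nn (k *: a) = `|k| * nn a.
Variables (V : finType) (b : V -> X) (F : X -> W) (lip : X -> R).
Hypothesis lipF : forall v, osc nn v (lip v) F.

Let G L := smooth L (map b (enum V)) F.
Let D L x := difference (b x) (G L).
Let vec (s : {ffun V -> int}) := \sum_x b x *~ s x.
Let lin L (s : {ffun V -> int}) mu := \sum_x (s x)%:~R *: D L x mu.

Let nnB := seminormB nnD nnZ.
Let nnN := seminormN nnZ.
Let nn0 := seminorm0 nnZ.

Let vecD s s' : vec (s + s') = vec s + vec s'.
Proof. by rewrite -big_split; apply: eq_bigr => x _; rewrite ffunE mulrzDr. Qed.
Let vecN s : vec (- s) = - vec s.
Proof. by rewrite -sumrN; apply: eq_bigr => x _; rewrite ffunE mulrNz. Qed.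
Let linD L s s' mu : lin L (s + s') mu = lin L s mu + lin L s' mu.
Proof.
by rewrite -big_split; apply: eq_bigr => x _; rewrite ffunE rmorphD/= scalerDl.
Qed.
Let linN L s mu : lin L (- s) mu = - lin L s mu.
Proof.
by rewrite -sumrN; apply: eq_bigr => x _; rewrite ffunE rmorphN/= scaleNr.
Qed.

(** All error terms are [K / L] with [K] independent of [L] and of the base
    point; their value does not matter. *)
Let lin_osc s v : exists K, forall L, (0 < L)%N ->
  osc nn v (K / L%:R) (lin L s).
Proof.
exists (\sum_x `|(s x)%:~R| * (2 * lip v)) => L L0 mu.
rewrite /difference /lin -sumrB.
apply: le_trans (seminorm_sum nnD nnZ _ _ _) _.
rewrite mulr_suml; apply: ler_sum => x _.
rewrite -scalerBr nnZ -mulrA ler_wpM2l//.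
by apply: osc_difference_smooth => //; rewrite map_f// mem_enum.
Qed.

Let linear s := exists K, forall L, (0 < L)%N -> forall mu,
  nn (difference (vec s) (G L) mu - lin L s mu) <= K / L%:R.

Let linear_add s s' : linear s -> linear s' -> linear (s + s').
Proof.
move=> [K hK] [K' hK']; have [K'' hK''] := lin_osc s' (vec s).
exists (K' + K + K'') => L L0 mu.
rewrite vecD linD /difference.
have -> : G L (mu + (vec s + vec s')) - G L mu - (lin L s mu + lin L s' mu) =
   (difference (vec s') (G L) (mu + vec s) - lin L s' (mu + vec s)) +
   (difference (vec s) (G L) mu - lin L s mu) +
   difference (vec s) (lin L s') mu.
  rewrite /difference addrA !opprD [X in _ = X + _]addrACA subrKA -[RHS]addrA.
  by congr (_ + _); rewrite addrACA addNr add0r.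
rewrite !mulrDl; apply: le_trans (nnD _ _) _; apply: lerD; last exact: hK''.
apply: le_trans (nnD _ _) _; apply: lerD; [exact: hK'|exact: hK].
Qed.

Let linear_opp s : linear s -> linear (- s).
Proof.
move=> [K hK]; have [K' hK'] := lin_osc s (vec s).
exists (K + K') => L L0 mu; rewrite vecN linN opprK.
set nu := mu - vec s; have numu : nu + vec s = mu by rewrite subrK.
have -> : difference (- vec s) (G L) mu + lin L s mu =
   - (difference (vec s) (G L) nu - lin L s nu) + difference (vec s) (lin L s) nu.
  by rewrite /difference !opprB numu -/nu [RHS]addrC subrKA addrC.
rewrite mulrDl; apply: le_trans (nnD _ _) _; rewrite nnN lerD//; [exact: hK|exact: hK'].
Qed.

Let linear0 : linear 0.
Proof.
exists 0 => L L0 mu; rewrite mul0r /vec /lin.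
under eq_bigr do rewrite ffunE mulr0z.
under [X in _ - X]eq_bigr do rewrite ffunE scale0r.
by rewrite !big1// /difference addr0 !subrr nn0.
Qed.

Definition int_dirac (x : V) : {ffun V -> int} := [ffun v => (v == x)%:Z].

Let vec1 x : vec (int_dirac x) = b x.
Proof.
rewrite /vec (bigD1 x)//= ffunE eqxx mulr1z big1 ?addr0// => y yx.
by rewrite ffunE (negbTE yx) mulr0z.
Qed.

Let lin1 L x mu : lin L (int_dirac x) mu = D L x mu.
Proof.
rewrite /lin (bigD1 x)//= ffunE eqxx scale1r big1 ?addr0// => y yx.
by rewrite ffunE (negbTE yx) scale0r.
Qed.

Let linear1 x : linear (int_dirac x).
Proof.
by exists 0 => L L0 mu; rewrite vec1 lin1 subrr nn0 mul0r.
Qed.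

Let linear_all s : linear s.
Proof.
have -> : s = \sum_x int_dirac x *~ s x.
  apply/ffunP => y; rewrite sum_ffunE (bigD1 y)//= big1 ?addr0.
    by rewrite ffunMzE ffunE eqxx intz.
  by move=> x xy; rewrite ffunMzE ffunE eq_sym (negbTE xy) mul0rz.
elim/big_ind: _ => [|? ?|x _]; [exact: linear0|exact: linear_add|].
have h n : linear (int_dirac x *+ n).
  elim: n => [|n ih]; first exact: linear0.
  by rewrite mulrS; exact: linear_add.
by case: (s x) => n; [exact: h|rewrite NegzE mulrNz; exact/linear_opp/h].
Qed.


Variables (I J : finType) (c : I -> R) (s : I -> {ffun V -> int}) (B : I -> R).
Variables (ex ey : J -> V) (p C : R).
Hypothesis c_ge0 : forall i, 0 <= c i.
Hypothesis p_ge0 : 0 <= p.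
Hypothesis poincare : forall g : V -> W,
  \sum_i c i * nn (\sum_x (s i x)%:~R *: g x) <=
  p * \sum_j nn (g (ex j) - g (ey j)).
Hypothesis edge : forall j, osc nn (b (ex j) - b (ey j)) C F.
Hypothesis lower : forall i M mu, M%:R * B i <= nn (difference (vec (s i) *+ M) F mu).

(** At every base point the unit increments of the smoothed map are, up to
    [O(1/L)], the values of a linear map, to which the Poincare inequality
    applies. *)
Let upper : exists K, forall L, (0 < L)%N -> forall mu,
  \sum_i c i * nn (difference (vec (s i)) (G L) mu) <=
  p * C * #|J|%:R + K / L%:R.
Proof.
have [Ks hKs] := choice (fun i => linear_all (s i)).
have [Ke hKe] := choice (fun j => linear_all (int_dirac (ex j) - int_dirac (ey j))).
exists (\sum_i c i * Ks i + p * \sum_j Ke j) => L L0 mu.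
apply: (@le_trans _ _ (\sum_i c i * (nn (lin L (s i) mu) + Ks i / L%:R))).
  apply: ler_sum => i _; rewrite ler_wpM2l//.
  set x := difference _ _ _; rewrite -(subrK (lin L (s i) mu) x) addrC.
  by apply: le_trans (nnD _ _) _; rewrite lerD2l; exact: hKs.
under eq_bigr do rewrite mulrDr mulrA.
rewrite big_split/= -mulr_suml.
rewrite [leRHS](_ : _ = p * C * #|J|%:R + p * (\sum_j Ke j) / L%:R + (\sum_i c i * Ks i) / L%:R); last by ring.
rewrite lerD2r.
apply: le_trans (poincare (fun x => D L x mu)) _.
rewrite -!mulrA -mulrDr ler_wpM2l//.
rewrite mulr_suml mulr_natr -sumr_const -big_split/=.
apply: ler_sum => j _.
have := hKe j L L0 mu; rewrite linD linN !lin1 vecD vecN !vec1.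
set x := difference (b (ex j) - b (ey j)) _ _.
set d := D L (ex j) mu - D L (ey j) mu => hd.
have -> : d = x - (x - d) by rewrite subKr.
apply: le_trans (nnB _ _) _; apply: lerD => //.
exact: osc_smooth.
Qed.

Let lower_smooth : exists2 K, 0 <= K & forall L M, (0 < L)%N -> forall i mu,
  M%:R * B i - K * L%:R <= \sum_(k < M) nn (difference (vec (s i)) (G L) (mu + vec (s i) *+ k)).
Proof.
pose c0 := \sum_x `|lip (b x)|.
have c00 : 0 <= c0 by apply: sumr_ge0.
exists (2 * (c0 * #|V|%:R)); first by rewrite !mulr_ge0.
move=> L M L0 i mu.
have close nu : nn (G L nu - F nu) <= c0 * #|V|%:R * L%:R.
  rewrite mulrAC; apply: le_trans (smooth_close nnD nnZ L0 c00 _ nu) _.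
    move=> u /mapP[x _ ->] nu'; apply: le_trans (lipF _ _) _.
    rewrite /c0 (bigD1 x)//=; apply: le_trans (ler_norm _) _.
    by rewrite lerDl sumr_ge0.
  by rewrite size_map -cardE.
rewrite lerBlDr; apply: le_trans (lower i M mu) _.
set v := vec (s i).
have -> : difference (v *+ M) F mu =
    \sum_(k < M) difference v (G L) (mu + v *+ k) -
      ((G L (mu + v *+ M) - F (mu + v *+ M)) - (G L mu - F mu)).
  have -> : \sum_(k < M) difference v (G L) (mu + v *+ k) = G L (mu + v *+ M) - G L mu.
    rewrite -(big_mkord xpredT (fun k => difference v (G L) (mu + v *+ k))).
    under eq_bigr do rewrite /difference -addrA -mulrSr.
    by rewrite (telescope_sumr (fun k => G L (mu + v *+ k)))// mulr0n addr0.
  rewrite /difference.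
  move: (G L (mu + _)) (G L mu) (F (mu + _)) (F mu) => x y z t.
  by rewrite !opprB -[y - t + _]addrA subrKA addrCA (addrCA x) subrr addr0 addrC.
apply: le_trans (nnB _ _) _; apply: lerD; first exact: (seminorm_sum nnD nnZ).
apply: le_trans (nnB _ _) _.
by rewrite -mulrA mulr_natl mulr2n lerD// mulrC mulrA mulrC mulrA mulrAC; apply: close.
Qed.

(** The smoothing error [O(L)] is divided by the length [M] of the segments and
    the linearization error is [O(1/L)]; with [M = L^2] both vanish. *)
Theorem linearized_poincare : \sum_i c i * B i <= p * C * #|J|%:R.
Proof.
have [K1 h1] := upper; have [K2 K20 h2] := lower_smooth.
have main L : (0 < L)%N -> \sum_i c i * B i <=
    p * C * #|J|%:R + (`|K1| + (\sum_i c i) * K2) / L%:R.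
  move=> L0; pose M := (L * L)%N; have M0 : (0 < M)%N by rewrite muln_gt0 L0.
  pose g i : X -> R^o := fun mu => nn (difference (vec (s i)) (G L) mu).
  pose us := [seq vec (s i) | i <- enum I].
  have up := smooth_le us M0 (h1 L L0) 0.
  have hg i : B i - K2 / L%:R <= smooth M us (g i) 0.
    have -> : B i - K2 / L%:R = (M%:R * B i - K2 * L%:R) / M%:R.
      have L0' : L%:R != 0 :> R by rewrite pnatr_eq0 -lt0n.
      by rewrite /M natrM; field.
    apply: (@smooth_ge _ _ _ _ (vec (s i))) => //; first by apply/mapP; exists i; rewrite ?mem_enum.
    by move=> mu; exact: h2.
  have := smooth_sum M us c g 0; rewrite /g => e; rewrite e {e} in up.
  rewrite mulrDl addrA -lerBlDr.
  apply: (@le_trans _ _ (p * C * #|J|%:R + K1 / L%:R)); last first.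
    by rewrite lerD2l ler_pM2r ?invr_gt0 ?ltr0n// ler_norm.
  apply: le_trans up; rewrite -mulrA mulr_suml -sumrB.
  by apply: ler_sum => i _; rewrite -mulrBr ler_wpM2l//; exact: hg.
rewrite leNgt; apply/negP => lt.
set K := (_ + _) in main; set U := p * C * _ in main lt.
have K0 : 0 <= K by rewrite addr_ge0// mulr_ge0// sumr_ge0.
set S := \sum_i _ in main lt.
have SU : 0 < S - U by rewrite subr_gt0.
have := archi_boundP (divr_ge0 K0 (ltW SU)); set n := Num.bound _ => hn.
have n0 : (0 < n)%N.
  by rewrite -(ltr0n R); apply: le_lt_trans hn; rewrite divr_ge0// ltW.
have := main n n0; rewrite -lerBlDl ler_pdivlMr ?ltr0n// => h.
by move: hn; rewrite ltr_pdivrMr// mulrC ltNge h.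
Qed.

End Transfer.


(** * Duality for the transportation cost norm *)
Section TransportNorm.
Variables (R : realType) (V : finType) (e : rel V).
Implicit Types (mu : TC R e) (w : V -> R).

Lemma graph_dist_le x p : path e x p -> graph_dist R e x (last x p) <= (size p)%:R.
Proof.
move=> xp; apply: ge_inf; last by exists p.
by exists 0 => _ [q [_ _ ->]].
Qed.

Lemma graph_dist_ge0 x y : 0 <= graph_dist R e x y.
Proof.
rewrite /graph_dist; set E := [set r | _].
have [->|/set0P E0] := eqVneq E set0; first by rewrite inf0.
by apply: lb_le_inf => // _ [q [_ _ ->]].
Qed.

Lemma lipschitz_graph_dist w x y : connect e x y ->
  (forall x y, e x y -> `|w x - w y| <= 1) -> w x - w y <= graph_dist R e x y.
Proof.
move=> /connectP[p xp ->] wlip; apply: lb_le_inf.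
  by exists (size p)%:R, p.
move=> _ [q [xq <- ->]] {p xp y}.
elim: q x xq => [|y q ih] x /=; first by rewrite subrr.
move=> /andP[/wlip xy /ih yq]; rewrite -(subrKA (w y)) -natr1 addrC lerD//.
by rewrite (le_trans (ler_norm _)).
Qed.

Lemma TC_norm_le n (a : 'I_n -> R) (x y : 'I_n -> V) mu :
  (forall i, 0 <= a i) ->
  mass mu = \sum_i a i *: (point_mass R (x i) - point_mass R (y i)) ->
  TC_norm mu <= \sum_i a i * graph_dist R e (x i) (y i).
Proof.
move=> a0 muE; apply: ge_inf; last by exists n, a, x, y.
exists 0 => _ [m [a' [x' [y' [a'0 _ ->]]]]].
by apply: sumr_ge0 => i _; rewrite mulr_ge0// graph_dist_ge0.
Qed.

Lemma sum_point_mass w x : \sum_v point_mass R x v * w v = w x.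
Proof.
rewrite (bigD1 x)//= ffunE eqxx mul1r big1 ?addr0// => y yx.
by rewrite ffunE (negbTE yx) mul0r.
Qed.

Lemma sum_mass mu : \sum_v mass mu v = 0.
Proof. by case: mu => /= m /eqP. Qed.

(** Without a representation the infimum would be the junk value 0: mass is
    exchanged between each vertex and a fixed one. *)
Lemma transport_exists (o : V) mu : exists (n : nat) (a : 'I_n -> R) (x y : 'I_n -> V),
  (forall i, 0 <= a i) /\
  mass mu = \sum_i a i *: (point_mass R (x i) - point_mass R (y i)).
Proof.
pose v (i : 'I_#|V|) := enum_val i : V; pose m i := mass mu (v i).
exists #|V|, (fun i => `|m i|), (fun i => if 0 <= m i then v i else o),
  (fun i => if 0 <= m i then o else v i); split=> //.
have -> : mass mu = \sum_x mass mu x *: (point_mass R x - point_mass R o).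
  apply/ffunP => y; rewrite sum_ffunE.
  under eq_bigr do rewrite !ffunE /GRing.scale/= mulrBr.
  rewrite sumrB -mulr_suml sum_mass mul0r subr0 (bigD1 y)//= eqxx mulr1.
  by rewrite big1 ?addr0// => x xy; rewrite eq_sym (negbTE xy) mulr0.
rewrite (reindex _ (onW_bij _ (enum_val_bij V)))/=.
apply: eq_bigr => i _; rewrite -/(v i) -/(m i); case: ifPn => [m0|].
  by rewrite ger0_norm.
by rewrite -ltNge => m0; rewrite ltr0_norm// scaleNr -scalerN opprB.
Qed.

(** Weak Kantorovich duality.  Connectedness keeps [graph_dist] away from its
    junk value. *)
Lemma le_TC_norm mu w : (forall x y, connect e x y) ->
  (forall x y, e x y -> `|w x - w y| <= 1) ->
  \sum_v mass mu v * w v <= TC_norm mu.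
Proof.
move=> conn wlip.
case: (pickP (@predT V)) => [z _|V0]; last first.
  rewrite big1 => [|v _]; last by have := V0 v.
  apply: lb_le_inf => [|_ [n [a [x [y [a0 _ ->]]]]]]; last first.
    by apply: sumr_ge0 => i _; rewrite mulr_ge0// graph_dist_ge0.
  have x (i : 'I_0) : V by case: i.
  exists 0, 0%N, (fun=> 0), x, x; split=> //; rewrite big_ord0//.
  by apply/ffunP => v; have := V0 v.
apply: lb_le_inf.
  have [n [a [x [y [a0 muE]]]]] := transport_exists z mu.
  by exists (\sum_i a i * graph_dist R e (x i) (y i)), n, a, x, y.
move=> _ [n [a [x [y [a0 -> ->]]]]].
under eq_bigr do rewrite sum_ffunE mulr_suml.
rewrite exchange_big/=; apply: ler_sum => i _.
under eq_bigr do rewrite !ffunE /GRing.scale/= -mulrA mulrBl.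
rewrite -mulr_sumr sumrB ler_wpM2l//.
have E (t : V) : \sum_v (v == t)%:R * w v = w t.
  by rewrite -[RHS]sum_point_mass; apply: eq_bigr => v _; rewrite ffunE.
by rewrite !E; exact: lipschitz_graph_dist.
Qed.

Lemma dipole_balanced x y : point_mass R x - point_mass R y \in @balanced R V.
Proof.
rewrite unfold_in; under eq_bigr do rewrite !ffunE.
have E (z : V) : \sum_v (v == z)%:R = 1 :> R.
  by rewrite -[RHS](sum_point_mass (fun=> 1) z); apply: eq_bigr => v _; rewrite ffunE mulr1.
by rewrite sumrB !E subrr.
Qed.

Definition dipole x y : TC R e := MkTC e (dipole_balanced x y).

Lemma TC_norm_dipole x y : TC_norm (dipole x y) <= graph_dist R e x y.
Proof.
apply: le_trans (@TC_norm_le 1 (fun=> 1) (fun=> x) (fun=> y) _ _ _) _ => //.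
  by rewrite big_ord1 scale1r.
by rewrite big_ord1 mul1r.
Qed.

End TransportNorm.


(** * Integration of scalar inequalities *)
Section L1Poincare.
Context d (T : measurableType d) (R : realType).
Variable mu : {measure set T -> \bar R}.
Let W := LfunType mu (@lexx _ _ 1%E).
Definition L1_norm (f : W) : R := fine ('N[mu]_1[EFin \o f]).

Lemma L1_normD (f g : W) : L1_norm (f + g) <= L1_norm f + L1_norm g.
Proof. exact: ler_LnormD. Qed.

Lemma L1_normZ (a : R) (f : W) : L1_norm (a *: f) = `|a| * L1_norm f.
Proof.
apply: EFin_inj; rewrite EFinM /L1_norm !finite_norm_fine.
by have := LnormZ f a.
Qed.

Lemma weighted_L1_norm (I : finType) (c : I -> R) (h : I -> W) :
  (forall i, 0 <= c i) ->
  (\sum_i c i * L1_norm (h i))%:E = (\int[mu]_x (\sum_i c i * `|h i x|)%R%:E)%E.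
Proof.
move=> c0; rewrite -sumEFin.
under [RHS]eq_integral do rewrite -sumEFin.
have mh i : measurable_fun setT (fun x => `|h i x|%:E).
  by apply/measurable_EFinP; exact: measurableT_comp.
rewrite ge0_integral_sum//.
- apply: eq_bigr => i _; rewrite EFinM /L1_norm finite_norm_fine Lnorm1.
  by rewrite -ge0_integralZl_EFin//; exact: mh.
- by move=> i; under eq_fun do rewrite EFinM; apply: measurable_funeM; exact: mh.
- by move=> i x _; rewrite lee_fin mulr_ge0.
Qed.

Lemma L1_sumE (I : finType) (a : I -> R) (g : I -> W) x :
  (\sum_i a i *: g i) x = \sum_i a i * g i x.
Proof. by elim/big_rec2: _ => // i y z _ <-. Qed.

Lemma L1_valued_poincare (I J V : finType) (c : I -> R) (a : I -> V -> R)
    (ex ey : J -> V) (p : R) :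
  (forall i, 0 <= c i) -> 0 <= p ->
  (forall f : V -> R, \sum_i c i * `|\sum_x a i x * f x| <=
    p * \sum_j `|f (ex j) - f (ey j)|) ->
  forall g : V -> W, \sum_i c i * L1_norm (\sum_x a i x *: g x) <=
    p * \sum_j L1_norm (g (ex j) - g (ey j)).
Proof.
move=> c0 p0 h g; rewrite mulr_sumr -lee_fin !weighted_L1_norm//.
have mW (f : W) : measurable_fun setT (fun x => `|f x|).
  exact: measurableT_comp.
have nonneg (K : finType) (b : K -> R) (f : K -> W) : (forall k, 0 <= b k) ->
    forall x, setT x -> (0 <= (\sum_k b k * `|f k x|)%R%:E)%E.
  by move=> b0 x Tx; rewrite lee_fin sumr_ge0// => k _; rewrite mulr_ge0.
have meas (K : finType) (b : K -> R) (f : K -> W) :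
    measurable_fun setT (fun x => (\sum_k b k * `|f k x|)%R%:E).
  apply/measurable_EFinP; apply: measurable_sum => k.
  by apply: measurable_funM => //; exact: mW.
apply: ge0_le_integral; [by []|by apply: nonneg|exact: meas|exact: (meas _ (fun=> p))|].
move=> x Tx; rewrite lee_fin -mulr_sumr.
under eq_bigr do rewrite L1_sumE.
exact: h (g^~ x).
Qed.

End L1Poincare.


(** * Poincare inequalities and distortion *)
Section DistortionBound.
Variables (R : realType) (V : finType) (e : rel V).

Lemma massD (mu nu : TC R e) : mass (mu + nu) = mass mu + mass nu.
Proof. by []. Qed.

Lemma mass_sum (K : finType) (f : K -> TC R e) : mass (\sum_k f k) = \sum_k mass (f k).
Proof. by apply: (big_morph (@mass R V e)). Qed.

Lemma massMn (mu : TC R e) n : mass (mu *+ n) = mass mu *+ n.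
Proof. by elim: n => // n ih; rewrite !mulrS massD ih. Qed.

Lemma massMz (mu : TC R e) z : mass (mu *~ z) = mass mu *~ z.
Proof.
case: z => n; first exact: massMn.
by rewrite NegzE !mulrNz; congr (- _); exact: massMn.
Qed.

Lemma mass_dipoles (o : V) (s : {ffun V -> int}) v : \sum_x s x = 0 ->
  mass (\sum_x dipole R e x o *~ s x) v = (s v)%:~R.
Proof.
move=> s0; rewrite mass_sum sum_ffunE.
transitivity (\sum_x ((s x)%:~R * (v == x)%:R - (s x)%:~R * (v == o)%:R) : R).
  apply: eq_bigr => x _; rewrite massMz ffunMzE /= !ffunE -mulrBr.
  by rewrite -mulrzl.
rewrite sumrB -mulr_suml -rmorph_sum/= s0 mul0r subr0 (bigD1 v)//= eqxx mulr1.
by rewrite big1 ?addr0// => x xv; rewrite eq_sym (negbTE xv) mulr0.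
Qed.

Let mu := lebesgue01 R.

Lemma L1_01_Lfun (f : L1_01 R) : (f : R -> R) \in Lfun mu 1.
Proof.
apply/andP; split; rewrite inE/=; last first.
  exact: Lebesgue_finite.

exact: (measurable_funPT (repr (LebesgueSpace.sort f))).
Qed.

Definition L1_repr (f : L1_01 R) : LfunType mu (@lexx _ _ 1%E) :=
  Lfun_Sub (@lexx _ _ 1%E) (L1_01_Lfun f).

Lemma L1_distE (f g : L1_01 R) : L1_dist f g = (L1_norm (L1_repr f - L1_repr g))%:E.
Proof. by rewrite /L1_norm finite_norm_fine. Qed.

(** Degenerate edges are allowed, so that edge families may be indexed by
    clamped steps of the grid. *)
Theorem distortion_ge (o : V) (I J : finType) (c : I -> R) (s : I -> {ffun V -> int})
    (phi : I -> V -> R) (ex ey : J -> V) (p C : R) (F : TC R e -> L1_01 R) :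
  (forall x y, connect e x y) ->
  (forall i, 0 <= c i) -> 0 <= p -> 0 <= C ->
  (forall i, \sum_x s i x = 0) ->
  (forall i x y, e x y -> `|phi i x - phi i y| <= 1) ->
  (forall j, ex j = ey j \/ e (ex j) (ey j)) ->
  (forall f : V -> R, \sum_i c i * `|\sum_x (s i x)%:~R * f x| <=
    p * \sum_j `|f (ex j) - f (ey j)|) ->
  (forall mu nu : TC R e, ((TC_norm (mu - nu))%:E <= L1_dist (F mu) (F nu))%E /\
    (L1_dist (F mu) (F nu) <= (C * TC_norm (mu - nu))%:E)%E) ->
  \sum_i c i * (\sum_x (s i x)%:~R * phi i x) <= p * C * #|J|%:R.
Proof.
move=> conn c0 p0 C0 s0 philip exy poincare bilip.
apply: (@linearized_poincare _ _ _ (@L1_norm _ _ _ mu) (@L1_normD _ _ _ _)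
  (@L1_normZ _ _ _ _) V (fun x => dipole R e x o) (L1_repr \o F)
  (fun v => C * TC_norm v) _ I J c s _ ex ey p C) => //.
- move=> v nu; have [_] := bilip (nu + v) nu.
  by rewrite L1_distE lee_fin /difference/= [_ - nu]addrC addKr.
- exact: L1_valued_poincare.
- move=> j nu; have [_] := bilip (nu + (dipole R e (ex j) o - dipole R e (ey j) o)) nu.
  rewrite L1_distE lee_fin /difference/= => /le_trans; apply.
  rewrite [_ - nu]addrC addKr -[leRHS]mulr1 ler_wpM2l//.
  have -> : dipole R e (ex j) o - dipole R e (ey j) o = dipole R e (ex j) (ey j).
    by apply: val_inj; rewrite /= opprB addrA subrK.
  apply: le_trans (TC_norm_dipole _ _ _ _) _.
  case: (exy j) => [->|h].
    by apply: le_trans (@graph_dist_le R V e (ey j) [::] _) _.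
  by have := @graph_dist_le R V e (ex j) [:: ey j]; rewrite /= h; apply.
- move=> i M nu; set v := \sum_x _.
  have [+ _] := bilip (nu + v *+ M) nu.
  rewrite L1_distE lee_fin /difference/=; apply: le_trans.
  rewrite [_ - nu]addrC addKr.
  apply: le_trans (le_TC_norm (v *+ M) conn (philip i)).
  rewrite massMn mulr_sumr; apply: ler_sum => x _.
  by rewrite ffunMnE mass_dipoles// -[in leRHS]mulr_natl mulrA.
Qed.

End DistortionBound.


(** * Reduction to indicator functions *)
Section LayerCake.
Variables (R : realDomainType) (V I J : finType).
Variables (c : I -> R) (a : I -> V -> R) (ex ey : J -> V) (p : R).
Hypothesis c_ge0 : forall i, 0 <= c i.
Hypothesis p_ge0 : 0 <= p.
Hypothesis a0 : forall i, \sum_x a i x = 0.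

Let lhs (f : V -> R) := \sum_i c i * `|\sum_x a i x * f x|.
Let rhs (f : V -> R) := p * \sum_j `|f (ex j) - f (ey j)|.

(** The left hand side is subadditive in [f] and the right hand side is additive
    along [f = min f b + (M - b) * indicator of (f >= M)], where [b] is the
    largest value of [f] below [M]. *)
Lemma layer_cake : (forall S : {set V}, lhs (fun x => (x \in S)%:R) <= rhs (fun x => (x \in S)%:R)) ->
  forall f, lhs f <= rhs f.
Proof.
move=> indicator f.
have [M fM] : exists M, forall x, f x <= M.
  exists (\sum_x `|f x|) => x; rewrite (bigD1 x)//=.
  by rewrite (le_trans (ler_norm _))// lerDl sumr_ge0.
have [n] := ubnP #|[set x | f x < M]%SET|.
elim: n => // n ih in f M fM *; rewrite ltnS => hn.
have [/existsP[x0 fx0]|/existsPn full] := boolP [exists x, f x < M]; last first.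
  have fE x : f x = M by apply/eqP; rewrite eq_le fM leNgt full.
  rewrite /lhs big1 => [|i _].
    by rewrite mulr_ge0// sumr_ge0.
  by under eq_bigr do rewrite fE; rewrite -mulr_suml a0 mul0r normr0 mulr0.
have [x1 fx1 max1] : exists2 x1, f x1 < M & forall x, f x < M -> f x <= f x1.
  by case: (@arg_maxP _ R V x0 (fun x => f x < M) f fx0) => x1 ? h; exists x1 => // x /h.
pose b := f x1; pose S := [set x | ~~ (f x < M)]%SET.
pose g x := Num.min (f x) b.
have fE x : f x = g x + (M - b) * (x \in S)%:R.
  rewrite inE /g; have [fx|fx] := ltP (f x) M.
    by rewrite mulr0 addr0 min_l// max1.
  have -> : f x = M by apply/eqP; rewrite eq_le fM.
  by rewrite mulr1 min_r ?(ltW fx1)// addrC subrK.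
have Mb : 0 <= M - b by rewrite subr_ge0 ltW.
have lhsE : lhs f <= lhs g + (M - b) * lhs (fun x => (x \in S)%:R).
  rewrite /lhs mulr_sumr -big_split; apply: ler_sum => i _ /=.
  rewrite mulrCA -mulrDr ler_wpM2l//.
  under eq_bigr do rewrite fE mulrDr mulrCA.
  rewrite big_split -mulr_sumr/=; apply: le_trans (ler_normD _ _) _.
  by rewrite normrM (ger0_norm Mb).
have rhsE : rhs f = rhs g + (M - b) * rhs (fun x => (x \in S)%:R).
  rewrite /rhs mulrCA -mulrDr; congr (_ * _).
  rewrite mulr_sumr -big_split; apply: eq_bigr => j _ /=.
  have gle x : g x <= b by rewrite /g ge_min lexx orbT.
  have gS x : x \in S -> g x = b.
    by rewrite inE -leNgt => Mx; rewrite /g min_r// (le_trans (ltW fx1)).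
  rewrite !fE; move: (gle (ex j)) (gle (ey j)) (gS (ex j)) (gS (ey j)).
  case: (ex j \in S); case: (ey j \in S) => /= h1 h2 h3 h4.
  - by rewrite h3// h4// !subrr normr0 mulr0 addr0.
  - by rewrite h3// subr0 normr1 !ger0_norm; lra.
  - by rewrite h4// sub0r normrN1 !ler0_norm; lra.
  - by rewrite mulr0 !addr0 subrr normr0 mulr0 addr0.
rewrite rhsE; apply: le_trans lhsE _; apply: lerD.
  apply: (ih g b) => [x|]; first by rewrite /g ge_min lexx orbT.
  apply: leq_trans hn; apply: proper_card; apply/properP; split.
    apply/fintype.subsetP => x; rewrite !inE /g gt_min ltxx orbF => h.
    exact: lt_trans h fx1.
  by exists x1; rewrite !inE// /g /b minxx ltxx.
by rewrite ler_wpM2l.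
Qed.
End LayerCake.

(** * Sums of independent terms *)
Section ProductMeasure.
Variables (R : realFieldType) (T A : finType).

Lemma sum_ffun1 (t : T) (h : A -> R) :
  (\sum_(X : {ffun T -> A}) h (X t)) * #|A|%:R = #|A|%:R ^+ #|T| * \sum_a h a.
Proof.
transitivity ((\prod_k \sum_a if k == t then h a else 1) * #|A|%:R).
  rewrite bigA_distr_bigA/=; congr (_ * _); apply: eq_bigr => X _.
  by rewrite (bigD1 t)//= eqxx big1 ?mulr1// => k /negbTE ->.
rewrite (bigD1 t)//= eqxx -mulrA mulrC; congr (_ * _).
rewrite (eq_bigr (fun=> #|A|%:R)) => [|k /negbTE ->]; last by rewrite sumr_const.
rewrite prodr_const -exprSr (@eq_card _ _ (predC1 t))// cardC1 prednK//.
by apply/card_gt0P; exists t.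
Qed.

Lemma sum_ffun2 (t u : T) (g h : A -> R) : t != u -> \sum_a g a = 0 ->
  \sum_(X : {ffun T -> A}) g (X t) * h (X u) = 0.
Proof.
move=> tu g0.
transitivity (\prod_k \sum_a if k == t then g a else if k == u then h a else 1).
  rewrite bigA_distr_bigA/=; apply: eq_bigr => X _.
  rewrite (bigD1 t)//= eqxx (bigD1 u)/=; last by rewrite eq_sym.
  rewrite eq_sym (negbTE tu) eqxx big1 ?mulr1// => k /andP[/negbTE -> /negbTE ->] //.
by rewrite (bigD1 t)//= eqxx g0 mul0r.
Qed.

Lemma second_moment (g : T -> A -> R) : (forall t, \sum_a g t a = 0) ->
  (\sum_(X : {ffun T -> A}) (\sum_t g t (X t)) ^+ 2) * #|A|%:R =
  #|A|%:R ^+ #|T| * \sum_t \sum_a g t a ^+ 2.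
Proof.
move=> g0.
under eq_bigr => X _ do rewrite expr2 big_distrlr/=.
rewrite exchange_big/= mulr_suml mulr_sumr; apply: eq_bigr => t _.
rewrite exchange_big/= (bigD1 t)//= [X in _ + X]big1 ?addr0 => [|u ut].
  by rewrite -(sum_ffun1 t (fun a => g t a ^+ 2)).
by apply: sum_ffun2 => //; rewrite eq_sym.
Qed.

Lemma mean_abs_le1 (g : T -> A -> R) :
  (\sum_(X : {ffun T -> A}) `|\sum_t g t (X t)|) * #|A|%:R <=
  #|A|%:R ^+ #|T| * \sum_t \sum_a `|g t a|.
Proof.
apply: (@le_trans _ _ ((\sum_(X : {ffun T -> A}) \sum_t `|g t (X t)|) * #|A|%:R)).
  by rewrite ler_wpM2r//; apply: ler_sum => X _; exact: ler_norm_sum.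
rewrite exchange_big/= mulr_suml mulr_sumr; apply: ler_sum => t _.
by rewrite (sum_ffun1 t (fun a => `|g t a|)).
Qed.

(** Second moment bound without square roots: [|y| <= (l + y^2 / l) / 2] for every
    [l > 0], to be optimized by the caller. *)
Lemma mean_abs_le2 (g : T -> A -> R) (v l : R) : (0 < #|A|)%N ->
  (forall t, \sum_a g t a = 0) -> 0 < l ->
  \sum_t \sum_a g t a ^+ 2 <= #|A|%:R * v ->
  \sum_(X : {ffun T -> A}) `|\sum_t g t (X t)| <=
  #|A|%:R ^+ #|T| * ((l + v / l) / 2).
Proof.
move=> A0 g0 l0 hv; have A0' : 0 < #|A|%:R :> R by rewrite ltr0n.
have young (y : R) : `|y| <= (l + y ^+ 2 / l) / 2.
  rewrite ler_pdivlMr// -subr_ge0 (_ : _ - _ = (l - `|y|) ^+ 2 / l).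
    by rewrite divr_ge0 ?sqr_ge0 ?ltW.
  by rewrite -(real_normK (num_real y)); field; rewrite gt_eqF.
apply: (@le_trans _ _ (\sum_(X : {ffun T -> A}) (l + (\sum_t g t (X t)) ^+ 2 / l) / 2)).
  by apply: ler_sum => X _; exact: young.
rewrite -mulr_suml big_split/= -mulr_suml sumr_const card_ffun -[l *+ _]mulr_natr natrX.
rewrite mulrA ler_pM2r ?invr_gt0// mulrDr [l * _]mulrC lerD2l mulrA ler_pM2r ?invr_gt0//.
by rewrite -(ler_pM2r A0') second_moment// -mulrA ler_wpM2l ?exprn_ge0// mulrC.
Qed.
End ProductMeasure.


(** * Edge isoperimetry in the grid *)
Section Isoperimetry.

(** Homogeneous form of the Bernoulli inequality [n w <= w^n + n - 1]. *)
Lemma weighted_amgm (R : realDomainType) (a b : R) n : 0 <= a -> 0 <= b ->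
  n.+1%:R * a * b ^+ n <= a ^+ n.+1 + n%:R * b ^+ n.+1.
Proof.
move=> a0 b0; elim: n => [|n ih]; first by rewrite expr0 !expr1; lra.
have h : 0 <= n.+1%:R * b ^+ n * (a - b) ^+ 2 by rewrite mulr_ge0 ?sqr_ge0// mulr_ge0// exprn_ge0.
have := ler_wpM2l a0 ih; rewrite -subr_ge0 => h'.
rewrite -subr_ge0; have := addr_ge0 h h'.
set z := (X in 0 <= X -> _); set w := (X in _ -> 0 <= X).
suff -> : w = z by [].
by rewrite /z /w !exprS -!natr1; ring.
Qed.

Lemma root_exists (R : realType) n (b : R) : 0 < b -> exists2 r, 0 < r & r ^+ n.+1 = b.
Proof.
move=> b0; exists (expR (ln b / n.+1%:R)); first exact: expR_gt0.
by rewrite -expRM_natl mulrC divfK ?pnatr_eq0// lnK.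
Qed.

(** [upd j o] projects along the direction [j]; unlike restriction to the other
    coordinates it stays in the same type, which allows an induction on sets of
    coordinates. *)
Definition upd (K A : finType) (j : K) (a : A) (x : {ffun K -> A}) : {ffun K -> A} :=
  [ffun k => if k == j then a else x k].

Lemma card_fibers (K A : finType) (S : {set {ffun K -> A}}) j :
  #|S| = (\sum_t #|[set x in S | x j == t]|)%N.
Proof.
rewrite -sum1_card (partition_big (fun x : {ffun K -> A} => x j) predT)//=.
by apply: eq_bigr => t _; rewrite -sum1dep_card.
Qed.

(** Additive Loomis-Whitney inequality; the best [y] is [#|S|^(-1/d)].  The slices
    [x j = t] embed into the projection of size [B] along [j], hence the
    induction hypothesis holds for them with the common parameter
    [y' = B^(-1/(d-1))].  Summing over [t], one is left with
    [B + (d-1) #|S| y' >= d #|S| y], which is the Bernoulli inequality. *)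
Lemma loomis_whitney (R : realType) (K A : finType) (o : A) (D : {set K})
    (S : {set {ffun K -> A}}) (y : R) :
  (forall x x', x \in S -> x' \in S -> forall k, k \notin D -> x k = x' k) ->
  0 <= y -> y ^+ #|D| * #|S|%:R <= 1 ->
  #|D|%:R * #|S|%:R * y <= (\sum_(j in D) #|upd j o @: S|)%:R.
Proof.
have [n] := ubnP #|D|; elim: n => // n ih in D S y *; rewrite ltnS => hn Sagree y0 yS.
have [->|[x0 x0S]] := set_0Vmem S; first by rewrite cards0 mulr0 mul0r.
have [D0|[j jD]] := set_0Vmem D; first by rewrite D0 cards0 !mul0r.
rewrite (big_setD1 j)//=; set B := #|upd j o @: S|; set D' := (D :\ j)%SET.
have B0 : (0 < B)%N by apply/card_gt0P; exists (upd j o x0); apply: imset_f.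
have cD : #|D| = #|D'|.+1 by rewrite (cardsD1 j) jD.
have [D'0|D'0] := posnP #|D'|.
  rewrite cD D'0 expr1 in yS.
  rewrite cD D'0 mul1r mulrC natrD; apply: le_trans yS _.
  by rewrite -[leLHS]addr0 lerD ?ler1n.
have B0' : 0 < B%:R :> R by rewrite ltr0n.
have Bi0 : 0 < (B%:R : R)^-1 by rewrite invr_gt0.
(* The common parameter of the slices. *)
have [y' y'0 y'E] := root_exists #|D'|.-1 Bi0.
rewrite prednK// in y'E.
pose St t := [set x in S | x j == t]%SET.
have StB t : (#|St t| <= B)%N.
  rewrite -(@card_in_imset _ _ (upd j o)) => [|x x'].
    by apply: subset_leq_card; apply/imsetS/fintype.subsetP => x; rewrite inE => /andP[].
  rewrite !inE => /andP[_ /eqP xt] /andP[_ /eqP x't] /ffunP e.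
  apply/ffunP => k; have := e k; rewrite !ffunE.
  by case: eqP => // -> _; rewrite xt x't.
have hSt t : #|D'|%:R * #|St t|%:R * y' <= (\sum_(i in D') #|upd i o @: St t|)%:R.
  apply: ih; rewrite -?cD//.
  - move=> x x'; rewrite !inE => /andP[xS /eqP xt] /andP[x'S /eqP x't] k.
    rewrite !inE negb_and negbK => /orP[/eqP ->|kD]; first by rewrite xt x't.
    exact: Sagree.
  - exact: ltW.
  - by rewrite y'E ler_pdivrMl ?ltr0n// mulr1 ler_nat.
have slices : #|D'|%:R * #|S|%:R * y' <= (\sum_(i in D') #|upd i o @: S|)%:R.
  rewrite (card_fibers S j) natr_sum mulr_sumr mulr_suml.
  apply: (@le_trans _ _ (\sum_t (\sum_(i in D') #|upd i o @: St t|)%:R)).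
    by apply: ler_sum => t _; exact: hSt.
  rewrite -natr_sum ler_nat exchange_big/=; apply: leq_sum => i.
  rewrite !inE => /andP[ij _]; rewrite (card_fibers _ j); apply: leq_sum => t _.
  apply: subset_leq_card; apply/fintype.subsetP => _ /imsetP[x + ->].
  rewrite !inE => /andP[xS /eqP xt]; rewrite imset_f ?inE ?xS ?xt//= ffunE.
  have -> : (j == i) = false by rewrite eq_sym (negbTE ij).
  by rewrite xt.
rewrite natrD; apply: le_trans (lerD (lexx _) slices).
have := weighted_amgm #|D'| y0 (ltW y'0); rewrite -cD => am.
have yB : y' ^+ #|D'| * B%:R = 1 by rewrite y'E mulVf// gt_eqF.
have S0 : 0 <= (#|S|%:R : R) * B%:R by rewrite mulr_ge0.
have := ler_wpM2r S0 am.
have -> : #|D|%:R * y * y' ^+ #|D'| * (#|S|%:R * B%:R) = #|D|%:R * #|S|%:R * y * (y' ^+ #|D'| * B%:R).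
  by ring.
rewrite yB mulr1 => /le_trans; apply.
have -> : (y ^+ #|D| + #|D'|%:R * y' ^+ #|D|) * (#|S|%:R * B%:R) =
  (y ^+ #|D| * #|S|%:R) * B%:R + #|D'|%:R * #|S|%:R * y' * (y' ^+ #|D'| * B%:R).
  by rewrite [in X in _ * y' ^+ X]cD exprS; ring.
by rewrite yB mulr1 lerD2r -[leRHS]mul1r ler_wpM2r.
Qed.

(** Clamping at the end of the path makes every point the source of a step; the
    steps that do not move contribute nothing to a variation. *)
Definition succ_clamped (m : nat) (a : 'I_m) : 'I_m := insubd a a.+1.

Lemma val_succ_clamped m (a : 'I_m) :
  succ_clamped a = (if a.+1 < m then a.+1 else a)%N :> nat.
Proof. by rewrite -val_insubd. Qed.

Lemma line_crossing m (g : 'I_m -> bool) : (exists a, g a) ->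
  (m <= m * \sum_a (g (succ_clamped a) != g a) + \sum_a g a)%N.
Proof.
move=> [b gb].
have [/forallP full|/forallPn[a ga]] := boolP [forall a, g a].
  rewrite [X in (_ <= _ + X)%N](_ : _ = m) ?leq_addl//.
  by under eq_bigr do rewrite full; rewrite sum1_card card_ord.
suff [k gk] : exists k, g (succ_clamped k) != g k.
  by rewrite (bigD1 k)//= gk mulnDr muln1 -!addnA leq_addr.
apply/existsP; apply: contraT => /existsPn same.
suff const n (h : (n < m)%N) : g (Ordinal h) = g (Ordinal (leq_ltn_trans (leq0n n) h)).
  have E (i : 'I_m) (h : (i < m)%N) : Ordinal h = i by apply: val_inj.
  have := const _ (ltn_ord a); have := const _ (ltn_ord b); rewrite !E gb (negbTE ga).
  by move=> hb ha; suff: true = false by []; rewrite hb ha; congr g; apply: val_inj.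
elim: n h => [|n ih] h; first by congr g; apply: val_inj.
have := same (Ordinal (ltnW h)); rewrite negbK => /eqP.
have -> : succ_clamped (Ordinal (ltnW h)) = Ordinal h.
  by apply: val_inj; rewrite /= val_succ_clamped /= h.
by move=> ->; rewrite ih; congr g; apply: val_inj.
Qed.

Variables (m d : nat).
Let V : finType := {ffun 'I_d -> 'I_m}.

Definition step (i : 'I_d) (x : V) : V := upd i (succ_clamped (x i)) x.

Definition perimeter (S : {set V}) : nat :=
  (\sum_i \sum_x ((step i x \in S) != (x \in S)))%N.

Lemma updK i a (x : V) : upd i (x i) (upd i a x) = x.
Proof. by apply/ffunP => k; rewrite !ffunE; case: eqP => // ->. Qed.

Lemma upd_upd i a b (x : V) : upd i a (upd i b x) = upd i a x.
Proof. by apply/ffunP => k; rewrite !ffunE; case: eqP. Qed.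

Lemma sum_line (h : V -> nat) i a (z : V) : z i = a ->
  (\sum_(x | upd i a x == z) h x = \sum_b h (upd i b z))%N.
Proof.
move=> zi; rewrite (reindex_onto (fun b => upd i b z) (fun x : V => x i))/=.
  apply: eq_bigl => b; rewrite upd_upd ffunE !eqxx andbT.
  by apply/eqP/ffunP => k; rewrite ffunE; case: eqP => // ->.
by move=> x /eqP <-; rewrite upd_upd; apply/ffunP => k; rewrite ffunE; case: eqP => // ->.
Qed.

(** Lines contained in [S] carry no boundary edge; they are paid for by their
    [m] points. *)
Lemma perimeter_line (o : 'I_m) (S : {set V}) i :
  (m * #|upd i o @: S| <= m * \sum_x ((step i x \in S) != (x \in S)) + #|S|)%N.
Proof.
set P := upd i o @: S.
have lines (h : V -> nat) : (\sum_(z in P) \sum_b h (upd i b z) <= \sum_x h x)%N.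
  rewrite [leqRHS](partition_big (upd i o) predT)//=.
  rewrite [leqRHS](bigID (mem P))/=; apply: leq_trans (leq_addr _ _).
  rewrite leq_eqVlt; apply/orP/or_introl/eqP/eq_bigr => z /imsetP[x _ zE].
  by rewrite sum_line// zE ffunE eqxx.
have cS : #|S| = (\sum_x (x \in S))%N.
  by rewrite -sum1_card big_mkcond; apply: eq_bigr => x _; case: (x \in S).
rewrite cS [X in (_ <= X + _)%N]big_distrr -big_split/=.
apply: leq_trans (lines (fun x => (m * ((step i x \in S) != (x \in S)) + (x \in S))%N)).
rewrite mulnC -sum_nat_const; apply: leq_sum => z /imsetP[x xS zE].
rewrite big_split/= -big_distrr/=.
have h := @line_crossing m (fun b => upd i b z \in S).
have /h : exists b, upd i b z \in S by exists (x i); rewrite zE updK.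
move=> /leq_trans; apply; rewrite leq_add2r leq_mul2l; apply/orP/or_intror.
by apply: leq_sum => b _; rewrite /step upd_upd ffunE eqxx.
Qed.

(** With [y = #|S|^(-1/d)] the bound is [d #|S|^(1-1/d)] up to the factor
    [1 - (#|S|/m^d)^(1/d)], which accounts for the lines that fill the grid. *)
Theorem isoperimetric (R : realType) (S : {set V}) (y : R) : (0 < m)%N ->
  0 <= y -> y ^+ d * #|S|%:R <= 1 ->
  d%:R * #|S|%:R * (y - m%:R^-1) <= (perimeter S)%:R.
Proof.
move=> m0 y0 yS; have m0' : 0 < m%:R :> R by rewrite ltr0n.
have cd : #|[set: 'I_d]%SET| = d by rewrite cardsT card_ord.
have := @loomis_whitney R 'I_d 'I_m (Ordinal m0) [set: 'I_d]%SET S y.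
rewrite cd => /(_ _ y0 yS) lw.
rewrite mulrBr lerBlDr; apply: le_trans (lw _) _ => [x x' _ _ k|].
  by rewrite inE.
rewrite -(ler_pM2l m0') mulrDr [X in _ + X](_ : _ = d%:R * #|S|%:R); last first.
  by field; rewrite gt_eqF.
rewrite -!natrM -natrD ler_nat /perimeter !big_distrr/=.
have -> : (d * #|S|)%N = (\sum_(i < d) #|S|)%N by rewrite sum_nat_const card_ord.
rewrite -big_split/= big_mkcond/=.
by apply: leq_sum => i _; rewrite inE; exact: perimeter_line.
Qed.

End Isoperimetry.


(** * Poincare inequalities on grids *)
Section Grid.
Variables (R : realType) (m d : nat).
Let V := grid m d.
Hypothesis m0 : (0 < m)%N.

Lemma grid_graph_upd (x : V) (i : 'I_d) (b : 'I_m) :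
  path_graph (x i) b -> grid_graph x (upd i b x).
Proof.
move=> xb; apply/existsP; exists i; rewrite ffunE eqxx xb/=.
by apply/forallP => j; apply/implyP => /negbTE ji; rewrite ffunE ji.
Qed.

Lemma grid_graphP (x y : V) : grid_graph x y ->
  exists2 i : 'I_d, y = upd i (y i) x & path_graph (x i) (y i).
Proof.
move=> /existsP[i /andP[xy /forallP h]]; exists i => //.
apply/ffunP => k; rewrite ffunE; case: eqP => [->//|/eqP ki].
by have := h k; rewrite ki/= => /eqP.
Qed.

Lemma lipschitz_grid (w : V -> R) :
  (forall (x : V) i (b : 'I_m), b = (x i).+1 :> nat -> `|w x - w (upd i b x)| <= 1) ->
  forall x y, grid_graph x y -> `|w x - w y| <= 1.
Proof.
move=> h x y /grid_graphP[i yE] /orP[/eqP xy|/eqP yx]; first by rewrite yE h.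
have xE : x = upd i (x i) y.
  by rewrite yE upd_upd; apply/ffunP => k; rewrite ffunE; case: eqP => // ->.
by have := h y i (x i) (esym yx); rewrite -xE distrC.
Qed.

Lemma connect_line (x : V) i (b : 'I_m) : connect (@grid_graph m d) x (upd i b x).
Proof.
have closer1 (a c n : nat) : (a - c + (c - a) <= n -> a < c ->
  a.+1 - c + (c - a.+1) < n)%N by lia.
have closer2 (a c n : nat) : (a - c + (c - a) <= n -> c < a ->
  a.-1 - c + (c - a.-1) < n)%N by lia.
have [n] := ubnP ((x i - b) + (b - x i))%N; elim: n => // n ih in x *; rewrite ltnS => hn.
have [xb|xb|xb] := ssrnat.ltngtP (x i) b.
- have h : ((x i).+1 < m)%N by apply: leq_ltn_trans xb _.
  rewrite -(upd_upd i b (Ordinal h)); apply: connect_trans (connect1 _) (ih _ _).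
    by apply: grid_graph_upd; rewrite /path_graph/= eqxx.
  by rewrite ffunE eqxx/=; exact: closer1 hn xb.
- have h : ((x i).-1 < m)%N by apply: leq_ltn_trans (leq_pred _) _.
  rewrite -(upd_upd i b (Ordinal h)); apply: connect_trans (connect1 _) (ih _ _).
    apply: grid_graph_upd; rewrite /path_graph/= prednK ?eqxx ?orbT//.
    exact: leq_ltn_trans xb.
  by rewrite ffunE eqxx/=; exact: closer2 hn xb.
- rewrite (_ : upd i b x = x)//; apply/ffunP => k; rewrite ffunE; case: eqP => // ->.
  by apply: val_inj.
Qed.

Lemma grid_connected (x y : V) : connect (@grid_graph m d) x y.
Proof.
have [n] := ubnP #|[set i | x i != y i]%SET|; elim: n => // n ih in x *; rewrite ltnS => hn.
have [->//|/eqP xy] := eqVneq x y.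
have [i xyi] : exists i, x i != y i.
  apply/existsP; apply: contraT => /existsPn h; case: xy.
  by apply/ffunP => i; apply/eqP; rewrite -[_ == _]negbK h.
apply: connect_trans (connect_line x i (y i)) (ih _ _).
apply: leq_trans hn; apply: proper_card; apply/properP; split.
  apply/fintype.subsetP => k; rewrite !inE ffunE.
  by case: (k =P i) => [->|//]; rewrite eqxx.
by exists i; rewrite !inE// ffunE !eqxx.
Qed.

Lemma step_edge (x : V) i : x = step i x \/ grid_graph x (step i x).
Proof.
rewrite /step; set b := succ_clamped _.
have bE := val_succ_clamped (x i); rewrite -/b in bE.
have [xm|xm] := ltnP (x i).+1 m; rewrite ?xm in bE.
  by right; apply: grid_graph_upd; rewrite /path_graph/= bE eqxx.
left; apply/ffunP => k; rewrite ffunE; case: eqP => // ->.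
by apply: val_inj; rewrite /= bE ltnNge xm.
Qed.

Lemma perimeterC (S : {set V}) : perimeter (~: S)%SET = perimeter S.
Proof.
apply: eq_bigr => i _; apply: eq_bigr => x _; rewrite !inE.
by case: (_ \in S); case: (_ \in S).
Qed.

Lemma variation_indicator (S : {set V}) :
  \sum_(j : 'I_d * V) `|(j.2 \in S)%:R - (step j.1 j.2 \in S)%:R| =
  (perimeter S)%:R :> R.
Proof.
rewrite -(pair_bigA _ (fun i (x : V) => `|(x \in S)%:R - (step i x \in S)%:R|))/=.
rewrite /perimeter natr_sum; apply: eq_bigr => i _.
rewrite natr_sum; apply: eq_bigr => x _.
by case: (x \in S); case: (step i x \in S) => /=;
  rewrite ?subrr ?subr0 ?sub0r ?normrN ?normr0 ?normr1.
Qed.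

Lemma card_grid : #|V| = (m ^ d)%N.
Proof. by rewrite card_ffun !card_ord. Qed.

(** Passing to the complement changes neither side of the Poincare inequality,
    since the measures have mass zero. *)
Theorem grid_distortion_ge (I : finType) (c : I -> R) (s : I -> {ffun V -> int})
    (phi : I -> V -> R) (p C : R) (F : TC R (@grid_graph m d) -> L1_01 R) :
  (forall i, 0 <= c i) -> 0 <= p -> 0 <= C ->
  (forall i, \sum_x s i x = 0) ->
  (forall k (x : V) i (b : 'I_m), b = (x i).+1 :> nat ->
    `|phi k x - phi k (upd i b x)| <= 1) ->
  (forall S : {set V}, (2 * #|S| <= m ^ d)%N ->
    \sum_i c i * `|\sum_x (s i x)%:~R * (x \in S)%:R| <= p * (perimeter S)%:R) ->
  (forall mu nu : TC R (@grid_graph m d),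
    ((TC_norm (mu - nu))%:E <= L1_dist (F mu) (F nu))%E /\
    (L1_dist (F mu) (F nu) <= (C * TC_norm (mu - nu))%:E)%E) ->
  \sum_i c i * (\sum_x (s i x)%:~R * phi i x) <= p * C * (d * m ^ d)%:R.
Proof.
move=> c0 p0 C0 s0 philip half bilip.
have -> : (d * m ^ d)%N = #|{: 'I_d * V}| by rewrite card_prod card_ord card_grid.
have o : V := [ffun=> Ordinal m0].
apply: (@distortion_ge R V (@grid_graph m d) o I ('I_d * V)%type c s phi snd (fun j => step j.1 j.2) p C F) => //.
- exact: grid_connected.
- by move=> i; apply: lipschitz_grid; exact: philip.
- by move=> j; exact: step_edge.
apply: layer_cake => // [i|S]; first by rewrite -rmorph_sum/= s0.
rewrite variation_indicator.
have [|big] := leqP (2 * #|S|) (m ^ d); first exact: half.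
rewrite -perimeterC.
have := half (~: S)%SET; have := cardsC S; rewrite card_grid => cS.
move=> /(_ ltac:(lia)); apply: le_trans; apply: ler_sum => i _.
rewrite ler_wpM2l// (_ : \sum_x _ = - \sum_x (s i x)%:~R * (x \in ~: S)%SET%:R).
  by rewrite normrN.
apply/eqP; rewrite -addr_eq0 -big_split/=; apply/eqP.
transitivity (\sum_x ((s i x)%:~R : R)); last by rewrite -rmorph_sum/= s0.
by apply: eq_bigr => x _; rewrite -mulrDr inE; case: (x \in S); rewrite ?addr0 ?add0r mulr1.
Qed.

End Grid.


(** * Geometric sums over scales *)
Definition ndist (a b : nat) : nat := (a - b) + (b - a).

(** The induction on [n] carries the exact value of the sum over all integers
    [a < n]. *)
Lemma geometric_two_sided (R : realFieldType) (z : R) n b : 0 <= z -> z < 1 ->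
  \sum_(a < n) z ^+ ndist a b <= (1 + z) / (1 - z).
Proof.
move=> z0 z1; have z1' : 0 < 1 - z by rewrite subr_gt0.
suff : \sum_(a < n) z ^+ ndist a b <=
    (if (n <= b)%N then z ^+ (b.+1 - n) else 1 + z - z ^+ (n - b)) / (1 - z).
  move=> /le_trans; apply; rewrite ler_pM2r ?invr_gt0//; case: leqP => h.
    have h' : z ^+ (b.+1 - n) <= 1 by rewrite exprn_ile1// ltW.
    by lra.
  by rewrite gerBl exprn_ge0.
elim: n => [|n ih]; first by rewrite big_ord0 leq0n divr_ge0 ?exprn_ge0// ltW.
rewrite big_ord_recr/=; apply: le_trans (lerD ih (lexx _)) _.
have z1n : 1 - z != 0 by rewrite gt_eqF.
case: (ssrnat.ltngtP n b) => nb; rewrite /ndist.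
- have -> : (n - b = 0)%N by apply/eqP; rewrite subn_eq0 ltnW.
  rewrite add0n subSS subSn 1?ltnW// exprS le_eqVlt; apply/orP; left.
  by apply/eqP; field.
- have -> : (b - n = 0)%N by apply/eqP; rewrite subn_eq0 ltnW.
  rewrite addn0 subSn 1?ltnW// exprS le_eqVlt; apply/orP; left.
  by apply/eqP; field.
- rewrite nb !subnn !subSnn addn0 expr0 expr1 le_eqVlt; apply/orP; left.
  by apply/eqP; field.
Qed.

Section DyadicRoot.
Variables (R : realType) (d : nat) (q : R).
Hypothesis d3 : (3 <= d)%N.
Hypothesis q0 : 0 < q.
Hypothesis qd : q ^+ d = 2.

Lemma root2_ge1 : 1 <= q.
Proof.
rewrite leNgt; apply/negP => q1.
have : q ^+ d <= 1 by rewrite exprn_ile1// ltW.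
by rewrite qd; lra.
Qed.

Lemma root2_le : q <= 32 / 25.
Proof.
rewrite leNgt; apply/negP => q1.
have q3 : q ^+ 3 <= q ^+ d by rewrite ler_weXn2l ?root2_ge1.
have q2 : (32 / 25) ^+ 3 <= q ^+ 3 by rewrite lerXn2r// ?nnegrE ?ltW//; lra.
by move: q3 q2; rewrite qd; lra.
Qed.

(** [1 = q^d - 1] is [q - 1] times a sum of [d] powers that are at most 2. *)
Lemma root2_gap : 1 <= 2 * d%:R * (q - 1).
Proof.
have := subrX1 q d; rewrite qd => e.
have {1}-> : 1 = (q - 1) * (\sum_(i < d) q ^+ i) by rewrite -e; lra.
rewrite mulrC; apply: ler_wpM2r; first by rewrite subr_ge0 root2_ge1.
rewrite mulrC; apply: sum_ord_le => i.
by rewrite -qd ler_weXn2l ?root2_ge1// ltnW.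
Qed.

Lemma root2_geom l : \sum_(j < l) q ^+ j <= 2 * d%:R * (q ^+ l - 1).
Proof.
rewrite subrX1 mulrA -[leLHS]mul1r ler_wpM2r//; last exact: root2_gap.
by apply: sumr_ge0 => i _; rewrite exprn_ge0 ?ltW.
Qed.

Lemma root2_pow_le l : (0 < l)%N -> q ^+ l <= 64 / 25 * d%:R * (q ^+ l - 1).
Proof.
case: l => // l _.
have h : 1 <= q ^+ l by rewrite exprn_ege1 ?root2_ge1.
have gap := root2_gap; have qle := root2_le; have d0 : 0 <= d%:R :> R by [].
rewrite exprS; set u := q ^+ l in h *.
apply: (@le_trans _ _ (32 / 25 * u)); first by rewrite ler_wpM2r//; lra.
have -> : 64 / 25 * d%:R * (q * u - 1) = 32 / 25 * (2 * d%:R * (q * u - 1)) by ring.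
rewrite ler_wpM2l//.
apply: (@le_trans _ _ (2 * d%:R * (q - 1) * u)); first by rewrite -[leLHS]mul1r ler_wpM2r//; lra.
rewrite -mulrA ler_wpM2l ?mulr_ge0//; lra.
Qed.

(** Sample sizes [2^j] below the inverse density [2^l] of a set see it to first
    order, larger ones with exponentially small relative error.  Since
    [q <= 32/25 < 4/3], both parts of the sum are dominated by the scale [l], and
    [q^l - 1] instead of [q^l] is what the isoperimetric inequality provides. *)
Lemma dyadic_sum J l : (0 < l)%N ->
  \sum_(j < J) q ^+ j * (if (j < l)%N then 2 else 3 / 2 * (3 / 4) ^+ (j - l)) <=
  100 * d%:R * (q ^+ l - 1).
Proof.
move=> l0; pose r : R := 24 / 25.
have q0' := ltW q0.
suff : \sum_(j < J) q ^+ j * (if (j < l)%N then 2 else 3 / 2 * (3 / 4) ^+ (j - l)) <=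
    2 * \sum_(j < minn J l) q ^+ j + 75 / 2 * q ^+ l * (1 - r ^+ (J - l)).
  move=> /le_trans; apply.
  have h1 : \sum_(j < minn J l) q ^+ j <= 2 * d%:R * (q ^+ l - 1).
    apply: le_trans (root2_geom l).
    rewrite (big_ord_widen l (fun j => q ^+ j) (geq_minr J l)) big_mkcond/=.
    by apply: ler_sum => j _; case: ifP => // _; rewrite exprn_ge0.
  have h2 : 75 / 2 * q ^+ l * (1 - r ^+ (J - l)) <= 75 / 2 * q ^+ l.
    rewrite -[leRHS]mulr1 ler_wpM2l ?mulr_ge0 ?exprn_ge0//.
    by rewrite gerBl exprn_ge0// /r; lra.
  by have := root2_pow_le l0; lra.
elim: J => [|J ih].
  by rewrite min0n !big_ord0 sub0n expr0 subrr !mulr0 addr0.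
rewrite big_ord_recr/=.
have [Jl|lJ] := ltnP J l.
  rewrite (minn_idPl (ltnW Jl)) in ih; rewrite (minn_idPl Jl).
  apply: le_trans (lerD ih (lexx _)) _.
  have /eqP -> : (J - l == 0)%N by rewrite subn_eq0 ltnW.
  have /eqP -> : (J.+1 - l == 0)%N by rewrite subn_eq0.
  by rewrite big_ord_recr/= mulrDr; lra.
rewrite (minn_idPr lJ) in ih; rewrite (minn_idPr (leqW lJ)).
apply: le_trans (lerD ih (lexx _)) _.
rewrite subSn// exprS -addrA lerD2l.
have -> : q ^+ J = q ^+ l * q ^+ (J - l) by rewrite -exprD subnKC.
set i := (J - l)%N.
have h : q ^+ i * (3 / 4) ^+ i <= r ^+ i.
  rewrite -exprMn lerXn2r// ?nnegrE; [by rewrite mulr_ge0//; lra|by rewrite /r; lra|].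
  by have := root2_le; rewrite /r; lra.
have ql : 0 <= q ^+ l by rewrite exprn_ge0.
have := ler_wpM2l ql h; rewrite /r => h'.
rewrite -subr_ge0; move: h'; rewrite -subr_ge0 mulrA => h'.
set z := (X in 0 <= X); set w := (X in 0 <= X) in h'.
have -> : z = 3 / 2 * w by rewrite /z /w; field.
by rewrite mulr_ge0//; lra.
Qed.
End DyadicRoot.


(** * Volume of balls *)
Section Ball.
Variables (R : realType) (m d : nat).
Let V : finType := {ffun 'I_d -> 'I_m}.

Definition l1_dist (x y : V) : nat := (\sum_i ndist (x i) (y i))%N.

Lemma l1_distxx (x : V) : l1_dist x x = 0%N.
Proof. by rewrite /l1_dist big1// => i _; rewrite /ndist subnn. Qed.

Lemma l1_dist_upd (x y : V) i (b : 'I_m) : b = (x i).+1 :> nat ->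
  (l1_dist x y <= (l1_dist (upd i b x) y).+1)%N /\
  (l1_dist (upd i b x) y <= (l1_dist x y).+1)%N.
Proof.
move=> bx.
have split (z : V) :
    l1_dist z y = (ndist (z i) (y i) + \sum_(k | k != i) ndist (z k) (y k))%N.
  by rewrite /l1_dist (bigD1 i).
rewrite !split ffunE eqxx.
have -> : (\sum_(k | k != i) ndist (upd i b x k) (y k) =
    \sum_(k | k != i) ndist (x k) (y k))%N.
  by apply: eq_bigr => k /negbTE ki; rewrite ffunE ki.
rewrite bx; move: (nat_of_ord (x i)) (nat_of_ord (y i)) (bigop _ _ _) => a c s.
by rewrite /ndist; split; lia.
Qed.

(** Exponential Markov inequality: the weights [(1 + h)^(-dist)] factor over the
    coordinates. *)
Lemma ball_volume (y : V) (h rho : R) : 0 < h ->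
  #|[set x | (l1_dist x y)%:R < rho]%SET|%:R <= expR (h * rho) * (1 + 2 / h) ^+ d.
Proof.
move=> h0; pose z := (1 + h)^-1.
have h1 : 0 < 1 + h by rewrite ltr_wpDl.
have z0 : 0 < z by rewrite invr_gt0.
have total : \sum_(x : V) z ^+ l1_dist x y <= (1 + 2 / h) ^+ d.
  under eq_bigr do rewrite /l1_dist expr_sum.
  rewrite -(bigA_distr_bigA (fun i (a : 'I_m) => z ^+ ndist a (y i)))/=.
  rewrite -[X in _ ^+ X]card_ord -prodr_const; apply: ler_prod => i _.
  rewrite sumr_ge0/= => [|a _]; last by rewrite exprn_ge0 ?ltW.
  apply: le_trans (geometric_two_sided _ _ (ltW z0) _) _.
    by rewrite invf_lt1 ?ltrDl.
  rewrite le_eqVlt; apply/orP; left; apply/eqP; rewrite /z; field.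
  by rewrite !gt_eqF.
have weight x : (l1_dist x y)%:R < rho -> 1 <= expR (h * rho) * z ^+ l1_dist x y.
  move=> xy; rewrite /z exprVn ler_pdivlMr ?exprn_gt0// mul1r.
  apply: (@le_trans _ _ (expR h ^+ l1_dist x y)).
    by rewrite lerXn2r ?nnegrE ?expR_ge0 ?expR_ge1Dx// ltW.
  by rewrite -expRM_natl ler_expR mulrC ler_pM2l// ltW.
apply: (@le_trans _ _ (expR (h * rho) * \sum_(x : V) z ^+ l1_dist x y)); last first.
  by rewrite ler_wpM2l ?expR_ge0.
rewrite -sum1_card natr_sum big_mkcond/= mulr_sumr; apply: ler_sum => x _.
rewrite inE; case: ifPn => [/weight//|_].
by rewrite mulr_ge0 ?expR_ge0// exprn_ge0 ?ltW.
Qed.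

(** [K^-d] is the density of the samples: the balls of radius [d K / 800] around
    them together cover at most half of the grid.  The parameter [h = 40 / K]
    makes the exponential factor [exp(d/20)] harmless against
    [(1/K + 1/20)^d <= (43/60)^d]. *)
Lemma small_ball (y : V) (K : R) : (3 <= d)%N -> 3 / 2 <= K ->
  #|[set x | (l1_dist x y)%:R < d%:R * K / 800]%SET|%:R <= K ^+ d / 2.
Proof.
move=> d3 K32; have K0 : 0 < K by apply: lt_le_trans K32; lra.
have h0 : 0 < 40 / K by rewrite divr_gt0.
apply: le_trans (ball_volume y (d%:R * K / 800) h0) _.
have -> : 40 / K * (d%:R * K / 800) = d%:R * (1 / 20) by field; rewrite gt_eqF.
have -> : 1 + 2 / (40 / K) = 1 + K / 20 by field; rewrite gt_eqF.
rewrite expRM_natl -exprMn.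
have e1 : expR (1 / 20) <= 20 / 19 :> R.
  have e0 : 0 < expR (1 / 20) :> R by exact: expR_gt0.
  have := expR_ge1Dx (- (1 / 20) : R); rewrite expRN => h.
  rewrite -(ler_pM2r e0) mulVf ?gt_eqF// in h; lra.
have base : expR (1 / 20) * (1 + K / 20) <= 43 / 57 * K.
  apply: (@le_trans _ _ (20 / 19 * (1 + K / 20))); first by rewrite ler_wpM2r//; lra.
  by lra.
apply: (@le_trans _ _ ((43 / 57 * K) ^+ d)).
  rewrite lerXn2r ?nnegrE//; first by rewrite mulr_ge0 ?expR_ge0//; lra.
  by rewrite mulr_ge0//; lra.
rewrite exprMn mulrC; apply: ler_wpM2l; first by rewrite exprn_ge0// ltW.
apply: (@le_trans _ _ ((43 / 57) ^+ 3 : R)); last by lra.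
by rewrite ler_wiXn2l//; lra.
Qed.
End Ball.


(** * Random samples *)
Section Sampling.
Variables (R : realType) (m d J : nat).
Let V : finType := grid m d.
Let T : finType := 'I_(2 ^ J).
Let N : nat := (m ^ d)%N.
Hypothesis m0 : (0 < m)%N.

Lemma sampling_card_gt0 : (0 < N)%N. Proof. by rewrite expn_gt0 m0. Qed.
Lemma sampling_cardR_gt0 : 0 < N%:R :> R. Proof. by rewrite ltr0n sampling_card_gt0. Qed.
Lemma sampling_card : #|V| = N. Proof. exact: card_grid. Qed.

Implicit Types (j : 'I_J) (X : {ffun T -> V}).

Lemma prefix_le j : (2 ^ j <= 2 ^ J)%N.
Proof. by rewrite leq_exp2l// ltnW. Qed.

Lemma sum_prefix j (u : R) : \sum_(k : T | (k < 2 ^ j)%N) u = (2 ^ j)%:R * u.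
Proof.
rewrite -(big_ord_widen (2 ^ J) (fun=> u) (prefix_le j)) sumr_const card_ord.
by rewrite mulr_natl.
Qed.

(** [2^j] random points against the uniform measure, times the number of grid
    points to be integral.  All scales use the first [2^j] entries of one long
    sample, so that they are indexed by the same finite type. *)
Definition sample_measure j X : {ffun V -> int} :=
  [ffun x => \sum_(k : T | (k < 2 ^ j)%N) (N%:Z * (x == X k)%:Z - 1)].

Lemma sample_measureE j X (f : V -> R) :
  \sum_x (sample_measure j X x)%:~R * f x =
  \sum_(k : T | (k < 2 ^ j)%N) (N%:R * f (X k) - \sum_x f x).
Proof.
under eq_bigr do rewrite ffunE rmorph_sum/= mulr_suml.
rewrite exchange_big/=; apply: eq_bigr => k _.
under eq_bigr do rewrite rmorphB rmorphM/= rmorph1 mulrBl mul1r.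
rewrite sumrB; congr (_ - _); rewrite (bigD1 (X k))//= eqxx mulr1 big1 ?addr0//.
by move=> x /negbTE ->; rewrite mulr0 mul0r.
Qed.

Lemma sample_measure_balanced j X : \sum_x sample_measure j X x = 0.
Proof.
apply: (@intr_inj R); rewrite rmorph_sum/=.
under eq_bigr do rewrite -[_%:~R]mulr1.
rewrite (sample_measureE j X (fun=> 1)) big1// => k _.
by rewrite sumr_const sampling_card mulr1 subrr.
Qed.

(** The Kantorovich potential; the diameter [d * m] only serves as the neutral
    value of the minimum. *)
Definition sample_dist j X (x : V) : R :=
  \big[Num.min/(d * m)%:R]_(k : T | (k < 2 ^ j)%N) (l1_dist x (X k))%:R.

Lemma sample_dist_ge0 j X x : 0 <= sample_dist j X x.
Proof. by apply/bigmin_geP; split=> // k _. Qed.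

Lemma sample_dist_sample j X (k : T) : (k < 2 ^ j)%N -> sample_dist j X (X k) = 0.
Proof.
move=> kj; apply/eqP; rewrite eq_le sample_dist_ge0 andbT.
rewrite /sample_dist; apply/bigmin_leP; right; exists k => //.
by rewrite l1_distxx.
Qed.

Lemma sample_dist_lip j X (x : V) i (b : 'I_m) : b = (x i).+1 :> nat ->
  `|sample_dist j X x - sample_dist j X (upd i b x)| <= 1.
Proof.
move=> bx.
have h (x1 x2 : V) : (forall y, (l1_dist x1 y <= (l1_dist x2 y).+1)%N) ->
    sample_dist j X x1 - 1 <= sample_dist j X x2.
  move=> x12; apply/bigmin_geP; split.
    by rewrite lerBlDr (le_trans (bigmin_le_id _ _ _ _))// lerDl.
  move=> k kj; rewrite lerBlDr natr1; apply/bigmin_leP; right; exists k => //.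
  by rewrite ler_nat.
have h1 := h x (upd i b x) (fun y => proj1 (l1_dist_upd y bx)).
have h2 := h (upd i b x) x (fun y => proj2 (l1_dist_upd y bx)).
by rewrite ler_norml; lra.
Qed.

(** The potential vanishes on the sample, so only the uniform part remains. *)
Lemma sample_measure_dist j X :
  \sum_x (sample_measure j X x)%:~R * - sample_dist j X x =
  (2 ^ j)%:R * \sum_x sample_dist j X x.
Proof.
rewrite sample_measureE -sum_prefix; apply: eq_bigr => k kj.
by rewrite sample_dist_sample// oppr0 mulr0 sub0r sumrN opprK.
Qed.

Lemma sum_sample_dist_ge j X (K : R) : (3 <= d)%N -> 3 / 2 <= K -> K <= m%:R ->
  (2 ^ j)%:R * K ^+ d = N%:R ->
  d%:R * K / 800 * (N%:R / 2) <= \sum_x sample_dist j X x.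
Proof.
move=> d3 K32 Km jK; set rho := d%:R * K / 800.
have K0 : 0 <= K by lra.
have rho0 : 0 <= rho.
  by clear jK; rewrite /rho -mulrA; apply: mulr_ge0; [exact: ler0n|lra].
have rho_le : rho <= (d * m)%:R.
  rewrite /rho natrM -mulrA; apply: ler_wpM2l; first exact: ler0n.
  by apply: le_trans Km; lra.
pose near := [set x | sample_dist j X x < rho]%SET.
have near_le : #|near|%:R <= N%:R / 2 :> R.
  rewrite -jK -mulrA -sum_prefix; clear jK.
  apply: (@le_trans _ _ (\sum_(k : T | (k < 2 ^ j)%N)
      #|[set x : V | (l1_dist x (X k))%:R < rho]%SET|%:R)); last first.
    by apply: ler_sum => k _; exact: small_ball.
  rewrite -natr_sum ler_nat -sum1_card.
  under [leqRHS]eq_bigr do rewrite -sum1_card big_mkcond/=.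
  rewrite exchange_big big_mkcond/=; apply: leq_sum => x _.
  rewrite inE; case: ifPn => // /bigmin_ltP[h|[k kj xk]].
    by move: rho_le; rewrite leNgt h.
  by rewrite (bigD1 k)//= inE xk leq_addr.
clear jK; apply: (@le_trans _ _ (\sum_(x in ~: near) rho)%SET).
  rewrite sumr_const -[rho *+ _]mulr_natl mulrC ler_wpM2r//.
  have := cardsC near; rewrite sampling_card => /(congr1 (fun n => n%:R : R)).
  by rewrite natrD; lra.
rewrite big_mkcond/=; apply: ler_sum => x _; rewrite !inE -leNgt.
by case: ifPn => // _; exact: sample_dist_ge0.
Qed.

Let NT : R := N%:R ^+ #|T|.
Lemma sampling_configurations_gt0 : 0 < NT. Proof. by rewrite exprn_gt0// sampling_cardR_gt0. Qed.

(** Entries beyond the first [2^j] are given the deviation 0, so that the whole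
    sample consists of independent centred terms. *)
Definition sample_deviation (S : {set V}) j (k : T) (a : V) : R :=
  if (k < 2 ^ j)%N then N%:R * (a \in S)%:R - #|S|%:R else 0.

Lemma sum_indicator (S : {set V}) : \sum_x (x \in S)%:R = #|S|%:R :> R.
Proof.
rewrite -sum1_card natr_sum [RHS]big_mkcond/=.
by apply: eq_bigr => x _; case: (x \in S).
Qed.

Lemma sample_measure_indicator (S : {set V}) j X :
  \sum_x (sample_measure j X x)%:~R * (x \in S)%:R = \sum_k sample_deviation S j k (X k).
Proof.
rewrite sample_measureE sum_indicator big_mkcond.
by apply: eq_bigr => k _; rewrite /sample_deviation; case: ifP.
Qed.

Lemma sum_sample_deviation S j k : \sum_a sample_deviation S j k a = 0.
Proof.
rewrite /sample_deviation; case: (k < 2 ^ j)%N; last by rewrite big1.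
rewrite sumrB -[X in X - _]mulr_sumr (sum_indicator S) sumr_const sampling_card.
by rewrite mulr_natl subrr.
Qed.


Lemma sum_abs_sample_deviation S j : \sum_k \sum_a `|sample_deviation S j k a| <= (2 ^ j)%:R * (2 * N%:R * #|S|%:R).
Proof.
rewrite -(sum_prefix j) [leRHS]big_mkcond/=; apply: ler_sum => k _.
rewrite /sample_deviation; case: (k < 2 ^ j)%N; last by rewrite big1// => a _; rewrite normr0.
apply: (@le_trans _ _ (\sum_a (N%:R * (a \in S)%:R + #|S|%:R))).
  apply: ler_sum => a _; apply: le_trans (ler_normB _ _) _.
  by rewrite !ger0_norm ?mulr_ge0.
by rewrite big_split/= -[X in X + _]mulr_sumr (sum_indicator S) sumr_const sampling_card -[_ *+ N]mulr_natl; lra.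
Qed.

Lemma sum_sqr_sample_deviation S j : \sum_k \sum_a sample_deviation S j k a ^+ 2 <=
  #|V|%:R * ((2 ^ j)%:R * N%:R * #|S|%:R).
Proof.
rewrite mulrA [X in X * _]mulrCA -!mulrA -(sum_prefix j) [leRHS]big_mkcond/=.
apply: ler_sum => k _.
rewrite /sample_deviation; case: (k < 2 ^ j)%N; last by rewrite big1// => a _; rewrite expr0n.
have -> : \sum_a (N%:R * (a \in S)%:R - #|S|%:R) ^+ 2 =
    \sum_a ((N%:R ^+ 2 - 2 * N%:R * #|S|%:R) * (a \in S)%:R + #|S|%:R ^+ 2) :> R.
  by apply: eq_bigr => a _; case: (a \in S) => /=; ring.
rewrite big_split/= -[X in X + _]mulr_sumr (sum_indicator S) sumr_const sampling_card -[_ *+ N]mulr_natl.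
have h : 0 <= N%:R * #|S|%:R ^+ 2 :> R by rewrite mulr_ge0 ?sqr_ge0.
by lra.
Qed.

Lemma sample_fluctuation1 S j : \sum_(X : {ffun T -> V}) `|\sum_k sample_deviation S j k (X k)| <=
  NT * (2 * (2 ^ j)%:R * #|S|%:R).
Proof.
have := mean_abs_le1 (fun k a => sample_deviation S j k a); rewrite sampling_card => h.
rewrite -(ler_pM2r sampling_cardR_gt0); apply: le_trans h _; rewrite -/NT.
have := ler_wpM2l (ltW sampling_configurations_gt0) (sum_abs_sample_deviation S j); move=> /le_trans; apply.
by rewrite le_eqVlt; apply/orP; left; apply/eqP; ring.
Qed.

(** The variance of the discrepancy is at most [2^j N #|S|], which is compared
    with the square of [2^j #|S| (3/4)^(j-l)]: the loss [(16/9)^(j-l)] is less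
    than the gain [2^(j-l)]. *)
Lemma sample_fluctuation2 (S : {set V}) j l : (0 < #|S|)%N -> (l <= j)%N ->
  (N < #|S| * 2 ^ l.+1)%N ->
  \sum_(X : {ffun T -> V}) `|\sum_k sample_deviation S j k (X k)| <=
  NT * ((2 ^ j)%:R * #|S|%:R * (3 / 2 * (3 / 4) ^+ (j - l))).
Proof.
move=> S0 lj Nl.
pose n : R := (2 ^ j)%:R; pose s : R := #|S|%:R; pose th : R := (3 / 4) ^+ (j - l).
have n0 : 0 < n by rewrite ltr0n expn_gt0.
have s0 : 0 < s by rewrite ltr0n.
have th0 : 0 < th by rewrite exprn_gt0//; lra.
have V0 : (0 < #|V|)%N by rewrite sampling_card sampling_card_gt0.
have l0 : 0 < n * s * th by apply: mulr_gt0; first exact: mulr_gt0.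
have := mean_abs_le2 V0 (sum_sample_deviation S j) l0 (sum_sqr_sample_deviation S j).
rewrite sampling_card -/NT -/n -/s -/th => /le_trans; apply.
apply: ler_wpM2l; first exact: (ltW sampling_configurations_gt0).
have Ns : N%:R <= s * 2 * 2 ^+ l.
  by rewrite -mulrA -exprS -natrX -natrM ler_nat ltnW.
have n2 : n = 2 ^+ l * 2 ^+ (j - l) by rewrite /n natrX -exprD subnKC.
have th2 : 1 <= th * th * 2 ^+ (j - l).
  rewrite /th -!exprMn exprn_ege1//; lra.
clearbody n s th.
have h : N%:R <= 2 * n * s * (th * th).
  apply: le_trans Ns _; rewrite n2.
  have p0 : 0 <= s * 2 * 2 ^+ l by rewrite !mulr_ge0 ?exprn_ge0 ?ltW.
  by have := ler_wpM2l p0 th2; lra.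
have -> : n * N%:R * s / (n * s * th) = N%:R / th by field; rewrite !gt_eqF.
have : N%:R / th <= 2 * (n * s * th).
  rewrite ler_pdivrMr//; apply: le_trans h _.
  by rewrite le_eqVlt; apply/orP; left; apply/eqP; ring.
have -> : n * s * (3 / 2 * th) = 3 / 2 * (n * s * th) by field.
by lra.
Qed.
End Sampling.


(** * Dimension at least three *)
(** Only the scales [2^(3j) <= m^d] are used: their spacing [m / q^j] is at least
    [m^(2/3) >= 3/2], as [small_ball] requires. *)
Theorem ln_card_le_of_dim_ge3 (R : realType) (m d : nat) (C : R)
    (F : TC R (@grid_graph m d) -> L1_01 R) :
  (2 <= m)%N -> (3 <= d)%N -> 0 <= C ->
  (forall mu nu : TC R (@grid_graph m d),
    ((TC_norm (mu - nu))%:E <= L1_dist (F mu) (F nu))%E /\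
    (L1_dist (F mu) (F nu) <= (C * TC_norm (mu - nu))%:E)%E) ->
  ln (m ^ d)%:R <= 3 * 400 ^+ 2 * C.
Proof.
have thirds l : (l < 3 * (l %/ 3).+1)%N by lia.
have h800 : 800 != 0 :> R by rewrite pnatr_eq0.
move=> m2 d3 C0 bilip.
have m0 : (0 < m)%N by apply: leq_trans m2.
have [q q0 qd] : exists2 q : R, 0 < q & q ^+ d = 2.
  by have [|q q0 qd] := @root_exists R d.-1 2; [|exists q; rewrite // -qd prednK//; apply: leq_trans d3].
have q1 := root2_ge1 q0 qd.
set N := (m ^ d)%N; have N0 : (0 < N)%N by rewrite expn_gt0 m0.
have /andP[logN1 logN2] := @trunc_log_bounds 2 N isT N0.
set L := trunc_log 2 N in logN1 logN2.
pose J := (L %/ 3).+1; pose n : R := N%:R; pose M : R := m%:R.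
have n0 : 0 < n by rewrite ltr0n.
have M0 : 0 < M by rewrite ltr0n.
have nM : n = M ^+ d by rewrite /n natrX.
pose T : finType := 'I_(2 ^ J); pose V : finType := grid m d.
pose NT : R := n ^+ #|T|.
have NT0 : 0 < NT by rewrite exprn_gt0.
have cardX : #|{ffun T -> V}|%:R = NT.
  by rewrite card_ffun natrX /NT /n /V card_grid.
pose c (i : 'I_J * {ffun T -> V}) : R := q ^+ i.1 / ((2 ^ i.1)%:R * n * NT).
have pow2 (j : nat) : 0 < (2 ^ j)%:R :> R by rewrite ltr0n expn_gt0.
have c0 i : 0 <= c i.
  by rewrite divr_ge0 ?exprn_ge0 ?mulr_ge0 ?(ltW q0) ?(ltW (pow2 _)) ?(ltW n0) ?(ltW NT0).
have p0 : 0 <= 100 * M / n by rewrite divr_ge0 ?mulr_ge0 ?(ltW M0) ?(ltW n0)//; lra.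
have sum_pair (f : 'I_J -> {ffun T -> V} -> R) :
    \sum_i c i * f i.1 i.2 =
    \sum_(j : 'I_J) q ^+ j / ((2 ^ j)%:R * n * NT) * \sum_X f j X.
  under [RHS]eq_bigr do rewrite mulr_sumr.
  by rewrite (pair_bigA _ (fun (j : 'I_J) X => q ^+ j / ((2 ^ j)%:R * n * NT) * f j X)).
have poincare (S : {set V}) : (2 * #|S| <= m ^ d)%N ->
    \sum_i c i * `|\sum_x (sample_measure i.1 i.2 x)%:~R * (x \in S)%:R| <=
    100 * M / n * (perimeter S)%:R.
  rewrite -/N => S2.
  rewrite (sum_pair (fun j X => `|\sum_x (sample_measure j X x)%:~R * (x \in S)%:R|)).
  have [->|S0] := eqVneq S finset.set0.
    rewrite big1 => [|j _].
      by rewrite mulr_ge0.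
    rewrite big1 ?mulr0// => X _; rewrite big1 ?normr0// => x _.
    by rewrite inE mulr0.
  rewrite -card_gt0 in S0.
  (* 2^l is the inverse density of S, rounded down to a power of 2. *)
  pose k := (N %/ #|S|)%N; pose l := trunc_log 2 k.
  have k2 : (2 <= k)%N by rewrite /k leq_divRL.
  have /andP[lk kl] := @trunc_log_bounds 2 k isT (ltnW k2).
  have l0 : (0 < l)%N by rewrite trunc_log_gt0.
  have Sl : (#|S| * 2 ^ l <= N)%N.
    by rewrite mulnC -leq_divRL.
  have Sl1 : (N < #|S| * 2 ^ l.+1)%N.
    by rewrite mulnC -ltn_divLR.
  pose s : R := #|S|%:R; have s0 : 0 < s by rewrite ltr0n.
  have term (j : 'I_J) : q ^+ j / ((2 ^ j)%:R * n * NT) *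
      (\sum_X `|\sum_x (sample_measure j X x)%:~R * (x \in S)%:R|) <=
      s / n * (q ^+ j * (if (j < l)%N then 2 else 3 / 2 * (3 / 4) ^+ (j - l))).
    set t := (if _ then _ else _ : R).
    have h : \sum_X `|\sum_x (sample_measure j X x)%:~R * (x \in S)%:R| <=
        NT * ((2 ^ j)%:R * s * t) :> R.
      under eq_bigr do rewrite sample_measure_indicator.
      rewrite /t; case: ltnP => [_|lj].
        have f1 : \sum_(X : {ffun T -> V}) `|\sum_k sample_deviation R S j k (X k)| <= NT * (2 * (2 ^ j)%:R * s).
          exact: sample_fluctuation1.
        apply: le_trans f1 _.
        by rewrite le_eqVlt; apply/orP; left; apply/eqP; ring.
      exact: sample_fluctuation2.
    have u0 : 0 <= q ^+ j / ((2 ^ j)%:R * n * NT) by exact: (c0 (j, [ffun=> [ffun=> Ordinal m0]])).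
    apply: le_trans (ler_wpM2l u0 h) _.
    rewrite le_eqVlt; apply/orP; left; apply/eqP; field.
    by rewrite !gt_eqF.
  apply: (@le_trans _ _ (\sum_(j : 'I_J) s / n *
      (q ^+ j * (if (j < l)%N then 2 else 3 / 2 * (3 / 4) ^+ (j - l))))).
    by apply: ler_sum => j _; exact: term.
  rewrite -mulr_sumr.
  have sn0 : 0 <= s / n by rewrite divr_ge0 ?ltW.
  apply: le_trans (ler_wpM2l sn0 (dyadic_sum d3 q0 qd J l0)) _.
  (* By the choice of l, the parameter q^l / m is admissible in the isoperimetric inequality. *)
  have y0 : 0 <= q ^+ l / M by rewrite divr_ge0 ?exprn_ge0 ?ltW.
  have yS : (q ^+ l / M) ^+ d * #|S|%:R <= 1.
    rewrite exprMn exprVn -nM exprAC qd mulrAC ler_pdivrMr// mul1r.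
    by rewrite -natrX -natrM ler_nat mulnC.
  have iso := isoperimetric m0 y0 yS; rewrite -/s -/M in iso.
  have c1 : 0 <= 100 * M / n :> R := p0.
  apply: le_trans (ler_wpM2l c1 iso).
  have alg (h e s' n' M' Q : R) : n' != 0 -> M' != 0 ->
      s' / n' * (h * e * (Q - 1)) = h * M' / n' * (e * s' * (Q / M' - M'^-1)).
    by move=> n'0 M'0; field; rewrite ?n'0 ?M'0.
  by rewrite (alg _ _ _ _ M) ?lexx ?gt_eqF.
have main := @grid_distortion_ge R m d m0 _ c (fun i => sample_measure i.1 i.2)
  (fun i x => - sample_dist R i.1 i.2 x) (100 * M / n) C F c0 p0 C0
  (fun i => sample_measure_balanced R i.1 i.2) _ poincare bilip.
have {}main : \sum_i c i * (\sum_x (sample_measure i.1 i.2 x)%:~R * - sample_dist R i.1 i.2 x)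
    <= 100 * M / n * C * (d%:R * n).
  have -> : d%:R * n = (d * m ^ d)%:R by rewrite natrM.
  apply: main => i x k b xb.
  by rewrite -opprD normrN; exact: sample_dist_lip.
have lower : J%:R * (d%:R * M / 800 / 2) <=
    \sum_i c i * (\sum_x (sample_measure i.1 i.2 x)%:~R * - sample_dist R i.1 i.2 x).
  rewrite (sum_pair (fun j X => \sum_x (sample_measure j X x)%:~R * - sample_dist R j X x)).
  rewrite mulr_natl -[X in _ *+ X]card_ord -sumr_const; apply: ler_sum => j _.
  have qj0 : 0 < q ^+ j by rewrite exprn_gt0.
  have qj1 : 1 <= q ^+ j by rewrite exprn_ege1.
  have q3j : q ^+ (j * 3) <= M.
    rewrite -(@ler_pXn2r _ d) ?nnegrE ?exprn_ge0 ?(ltW q0) ?(ltW M0)//; last first.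
      by apply: leq_trans d3.
    rewrite exprAC qd -nM -natrX ler_nat; apply: leq_trans logN1.
    rewrite leq_exp2l// -leq_divRL//.
    by have := ltn_ord j; rewrite ltnS.
  have M2 : 2 <= M by rewrite ler_nat.
  (* From q^(3j) <= m and m >= 2, hence (m / q^j)^3 >= m^2 >= 4 > (3/2)^3. *)
  have K32 : 3 / 2 <= M / q ^+ j.
    rewrite ler_pdivlMr// leNgt; apply/negP => h.
    rewrite exprM in q3j; set u := q ^+ j in h qj0 q3j.
    have h3 : M ^+ 3 <= (3 / 2 * u) ^+ 3.
      by rewrite lerXn2r ?nnegrE ?(ltW h) ?(ltW M0) ?mulr_ge0 ?(ltW qj0)//; lra.
    have M3 : 4 * M <= M ^+ 3.
      have : 0 <= (M - 2) * (M + 2) * M.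
        by rewrite !mulr_ge0 ?subr_ge0 ?addr_ge0 ?(ltW M0).
      by rewrite !exprS expr0; lra.
    have : (3 / 2 * u) ^+ 3 = 27 / 8 * u ^+ 3 by rewrite exprMn; congr (_ * _); lra.
    by lra.
  have KM : M / q ^+ j <= M by rewrite ler_pdivrMr// ler_peMr// ltW.
  have jK : (2 ^ j)%:R * (M / q ^+ j) ^+ d = n.
    rewrite exprMn exprVn exprAC qd natrX mulrCA mulfV ?mulr1 ?nM//.
  set rho := d%:R * M / 800 / 2.
  have far (X : {ffun T -> V}) : d%:R * (M / q ^+ j) / 800 * (n / 2) <=
      \sum_x sample_dist R j X x by exact: sum_sample_dist_ge.
  have a0 := c0 (j, [ffun=> [ffun=> Ordinal m0]]).
  apply: (@le_trans _ _ (q ^+ j / ((2 ^ j)%:R * n * NT) *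
      (\sum_(X : {ffun T -> V}) (2 ^ j)%:R * (d%:R * (M / q ^+ j) / 800 * (n / 2))))); last first.
    apply: ler_wpM2l; first exact: a0.
    apply: ler_sum => X _; rewrite sample_measure_dist.
    by apply: ler_wpM2l; [exact: ltW|exact: far].
  rewrite sumr_const -[_ *+ #|_|]mulr_natl cardX /rho.
  have alg (e Q a b n' M' t : R) : Q != 0 -> b != 0 -> n' != 0 -> t != 0 -> a != 0 ->
      Q / (b * n' * t) * (t * (b * (e * (M' / Q) / a * (n' / 2)))) = e * M' / a / 2.
    by move=> Q0 b0 n'0 t0 a0'; field; rewrite a0' t0 n'0 b0 Q0.
  rewrite (alg _ _ _ _ _ _ _ (lt0r_neq0 qj0) (lt0r_neq0 (pow2 j))
    (lt0r_neq0 n0) (lt0r_neq0 NT0) h800).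
  exact: lexx.
have JC : J%:R <= 400 ^+ 2 * C.
  have := le_trans lower main; rewrite [leRHS](_ : _ = 100 * C * (d%:R * M)); last first.
    by field; rewrite gt_eqF.
  have d0 : 0 < d%:R :> R by rewrite ltr0n; apply: leq_trans d3.
  have dM0 : 0 < d%:R * M by rewrite mulr_gt0.
  have alg (a e u : R) : a != 0 -> u * (e / a / 2) = u / a / 2 * e.
    by move=> a0; field; rewrite a0.
  rewrite (alg _ _ _ h800).
  by rewrite ler_pM2r//; lra.
have lnN : ln n <= 3 * J%:R.
  have N2 : n <= 2 ^+ (3 * J).
    rewrite -natrX ler_nat; apply: ltnW; apply: leq_trans logN2 _.
    by rewrite leq_exp2l//; exact: thirds.
  apply: (@le_trans _ _ (ln (2 ^+ (3 * J) : R))); first by rewrite ler_ln ?posrE ?exprn_gt0.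
  rewrite lnXn// -[ln 2 *+ _]mulr_natr natrM.
  have ln2 : ln (2 : R) <= 1.
    by have := @le_ln1Dx R 1; rewrite (_ : 1 + 1 = 2)//; apply.
  by rewrite -[leRHS]mul1r ler_wpM2r// mulr_ge0.
by apply: le_trans lnN _; rewrite -mulrA ler_wpM2l.
Qed.


(** * Random Haar functions in the plane *)
Section Plane.
Variables (R : realType) (m h : nat).
Let V : finType := grid m 2.
Let K : nat := (4 * h)%N.
Let T : finType := ('I_m * 'I_m)%type.
Hypothesis h_gt0 : (0 < h)%N.

Let i0 : 'I_2 := ord0.
Let i1 : 'I_2 := lift ord0 ord0.

Definition shift (r : nat) (x : V) : V := upd i0 (insubd (x i0) (x i0 + r)%N) x.

Lemma shift_coord r (x : V) : (x i0 + r < m)%N -> shift r x i0 = (x i0 + r)%N :> nat.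
Proof. by move=> xr; rewrite ffunE eqxx val_insubd xr. Qed.

Lemma shift_other r (x : V) : shift r x i1 = x i1.
Proof. by rewrite ffunE. Qed.

Lemma shift0 (x : V) : shift 0 x = x.
Proof.
apply/ffunP => k; rewrite ffunE; case: eqP => // ->.
by apply: val_inj; rewrite val_insubd addn0 ltn_ord.
Qed.

Lemma shiftS r (x : V) : (x i0 + r.+1 < m)%N -> shift r.+1 x = step i0 (shift r x).
Proof.
move=> xr; have xr' : (x i0 + r < m)%N by apply: leq_ltn_trans xr; rewrite leq_add2l.
rewrite /step /shift upd_upd ffunE eqxx; congr (upd _ _ _); apply: val_inj.
by rewrite val_insubd xr/= val_succ_clamped val_insubd xr' -addnS xr.
Qed.

Lemma plane_ext (x y : V) : x i0 = y i0 -> x i1 = y i1 -> x = y.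
Proof.
move=> e0 e1; apply/ffunP => k; have [->//|k0] := eqVneq k i0.
by have -> : k = i1 by apply: val_inj; case: k k0 => -[|[|]].
Qed.

Lemma shift_inj r (x y : V) : (x i0 + r < m)%N -> (y i0 + r < m)%N ->
  shift r x = shift r y -> x = y.
Proof.
move=> xr yr e; apply: plane_ext; last by rewrite -(shift_other r x) e shift_other.
apply: val_inj; apply: (@addIn r).
by rewrite /= -(shift_coord xr) -(shift_coord yr) e.
Qed.

Lemma sum_shift_le (r : nat) (E : {set V}) (f : V -> R) : (forall x, 0 <= f x) ->
  (forall x, x \in E -> (x i0 + r < m)%N) ->
  \sum_(x in E) f (shift r x) <= \sum_x f x.
Proof.
move=> f0 Er.
have inj : {in E &, injective (shift r)}.
  by move=> x y xE yE; apply: shift_inj; exact: Er.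
rewrite -(big_imset f inj) big_mkcond/=; apply: ler_sum => x _.
by case: ifP.
Qed.

(** Rectangles of size [2K x K] are split into two squares; a point of the left
    square is kept when its partner in the right square lies in the grid. *)
Definition left_half : {set V} :=
  [set x : V | ~~ odd (x i0 %/ K) & (x i0 + K < m)%N]%SET.

Lemma cell_proof (a : 'I_m) k : (a %/ k < m)%N.
Proof. exact: leq_ltn_trans (leq_div _ _) (ltn_ord a). Qed.

Lemma cell_proof2 (a : 'I_m) : (a %/ K %/ 2 < m)%N.
Proof. exact: leq_ltn_trans (leq_div _ _) (cell_proof a K). Qed.

Definition cell (x : V) : T := (Ordinal (cell_proof2 (x i0)), Ordinal (cell_proof (x i1) K)).

Implicit Types (eps : {ffun T -> bool}).

(** A sum with random signs of the Haar functions of these rectangles. *)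
Definition haar_measure eps : {ffun V -> int} :=
  [ffun v => \sum_(x in left_half)
     (-1) ^+ eps (cell x) * ((v == x)%:Z - (v == shift K x)%:Z)].

Lemma haar_measureE eps (f : V -> R) :
  \sum_v (haar_measure eps v)%:~R * f v =
  \sum_(x in left_half) (-1) ^+ eps (cell x) * (f x - f (shift K x)).
Proof.
under eq_bigr do rewrite ffunE rmorph_sum/= mulr_suml.
rewrite exchange_big/=; apply: eq_bigr => x _.
under eq_bigr do rewrite rmorphM/= rmorphXn/= rmorphN1 rmorphB/= -mulrA.
rewrite -mulr_sumr; congr (_ * _); under eq_bigr do rewrite mulrBl.
have E (z : V) : \sum_v ((v == z)%:Z)%:~R * f v = f z.
  by rewrite (bigD1 z)//= eqxx mul1r big1 ?addr0// => v /negbTE ->; rewrite mul0r.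
by rewrite sumrB !E.
Qed.

Lemma haar_measure_balanced eps : \sum_v haar_measure eps v = 0.
Proof.
apply: (@intr_inj R); rewrite rmorph_sum/=.
under eq_bigr do rewrite -[_%:~R]mulr1.
by rewrite (haar_measureE eps (fun=> 1)) big1// => k _; rewrite subrr mulr0.
Qed.

Definition cell_gap (S : {set V}) (Q : T) : R :=
  \sum_(x in left_half | cell x == Q) ((x \in S)%:R - (shift K x \in S)%:R).

Lemma haar_measure_indicator eps (S : {set V}) :
  \sum_v (haar_measure eps v)%:~R * (v \in S)%:R =
  \sum_Q (-1) ^+ eps Q * cell_gap S Q.
Proof.
rewrite haar_measureE (partition_big cell predT)//=; apply: eq_bigr => Q _.
by rewrite mulr_sumr; apply: eq_bigr => x /andP[_ /eqP ->].
Qed.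

Let gap (S : {set V}) (x : V) : R := `|(x \in S)%:R - (shift K x \in S)%:R|.

Lemma sum_cell_gap_le (S : {set V}) :
  \sum_Q `|cell_gap S Q| <= \sum_(x in left_half) gap S x.
Proof.
rewrite [leRHS](partition_big cell predT)//=; apply: ler_sum => Q _.
exact: ler_norm_sum.
Qed.

Lemma left_half_shift x : x \in left_half -> (x i0 + K < m)%N.
Proof. by rewrite inE => /andP[]. Qed.

Lemma sum_gap_le_card (S : {set V}) :
  \sum_(x in left_half) gap S x <= 2 * #|S|%:R.
Proof.
have ind : \sum_x (x \in S)%:R = #|S|%:R :> R.
  rewrite -sum1_card natr_sum [RHS]big_mkcond/=.
  by apply: eq_bigr => x _; case: (x \in S).
apply: (@le_trans _ _ (\sum_(x in left_half) ((x \in S)%:R + (shift K x \in S)%:R))).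
  by apply: ler_sum => x _; apply: le_trans (ler_normB _ _) _; rewrite !ger0_norm.
rewrite big_split/= mulr_natl mulr2n -ind; apply: lerD.
  by rewrite big_mkcond/=; apply: ler_sum => x _; case: ifP.
by apply: (@sum_shift_le K _ (fun x => (x \in S)%:R)) => // x; exact: left_half_shift.
Qed.

(** The segment from [x] to its partner crosses the boundary when [gap] is not
    zero, and for each [r] the [r]-th step of this segment determines [x]. *)
Lemma sum_gap_le_perimeter (S : {set V}) :
  \sum_(x in left_half) gap S x <= K%:R * (perimeter S)%:R.
Proof.
pose var (x : V) : R := `|(x \in S)%:R - (step i0 x \in S)%:R|.
apply: (@le_trans _ _ (\sum_(x in left_half) \sum_(r < K) var (shift r x))).
  apply: ler_sum => x xE; rewrite /gap.
  have -> : (x \in S)%:R - (shift K x \in S)%:R =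
      \sum_(r < K) ((shift r x \in S)%:R - (step i0 (shift r x) \in S)%:R) :> R.
    transitivity (- \sum_(0 <= r < K) ((shift r.+1 x \in S)%:R - (shift r x \in S)%:R) : R).
      by rewrite (telescope_sumr (fun r => (shift r x \in S)%:R))// shift0 opprB.
    rewrite -sumrN big_mkord; apply: eq_bigr => r _; rewrite opprB shiftS//.
    by apply: leq_ltn_trans (left_half_shift xE); rewrite leq_add2l.
  exact: ler_norm_sum.
rewrite exchange_big/=; apply: sum_ord_le => r.
apply: (@le_trans _ _ (\sum_x var x)).
  apply: sum_shift_le => [x|x /left_half_shift]; first exact: normr_ge0.
  by apply: leq_ltn_trans; rewrite leq_add2l ltnW.
rewrite /perimeter (bigD1 i0)//= natrD natr_sum; apply: ler_wpDr; first exact: ler0n.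
apply: ler_sum => x _; rewrite /var.
by case: (x \in S); case: (step i0 x \in S) => /=;
  rewrite ?subrr ?subr0 ?sub0r ?normrN ?normr0 ?normr1.
Qed.

Lemma cell_gap_le (S : {set V}) Q : `|cell_gap S Q| <= (K * K)%:R.
Proof.
have K0 : (0 < K)%N by rewrite muln_gt0.
apply: le_trans (ler_norm_sum _ _ _) _.
apply: (@le_trans _ _ (\sum_(x in left_half | cell x == Q) 1)).
  apply: ler_sum => x _.
  by case: (x \in S); case: (shift K x \in S) => /=;
    rewrite ?subrr ?subr0 ?sub0r ?normrN ?normr0 ?normr1.
rewrite sumr_const ler_nat.
have mod_lt a : (a %% K < K)%N by rewrite ltn_mod.
pose g (x : V) : 'I_K * 'I_K := (Ordinal (mod_lt (x i0)), Ordinal (mod_lt (x i1))).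
have <- : #|{: 'I_K * 'I_K}| = (K * K)%N by rewrite card_prod card_ord.
apply: (@leq_card_in _ _ g) => x y /andP[xE /eqP xQ] /andP[yE /eqP yQ] [g0 g1].
move: xQ; rewrite -yQ => -[c0 c1].
have half (z : V) : z \in left_half -> z i0 = (z i0 %/ K %/ 2 * 2 * K + z i0 %% K)%N :> nat.
  rewrite inE => /andP[ev _]; rewrite [LHS](divn_eq _ K); congr (_ * _ + _)%N.
  by rewrite divn2 muln2 even_halfK.
apply: plane_ext; apply: val_inj => /=; first by rewrite (half x)// (half y)// c0 g0.
by rewrite (divn_eq (x i1) K) (divn_eq (y i1) K) c1 g1.
Qed.


Let PT : R := 2 ^+ #|T|.

Lemma haar_fluctuation1 (S : {set V}) :
  \sum_(eps : {ffun T -> bool}) `|\sum_Q (-1) ^+ eps Q * cell_gap S Q| <=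
  PT * (2 * #|S|%:R).
Proof.
have := mean_abs_le1 (fun (Q : T) (b : bool) => (-1) ^+ b * cell_gap S Q).
rewrite card_bool -/PT => le1.
rewrite -(@ler_pM2r _ 2)//; apply: le_trans le1 _.
rewrite -mulrA; apply: ler_wpM2l; first by rewrite exprn_ge0.
apply: (@le_trans _ _ (\sum_Q `|cell_gap S Q| * 2)).
  by apply: ler_sum => Q _; rewrite big_bool !normrMsign mulr_natr mulr2n.
rewrite -mulr_suml ler_pM2r//.
exact: le_trans (sum_cell_gap_le S) (sum_gap_le_card S).
Qed.

(** A cell has gap at most [K^2], and the gaps sum up to at most [K] times the
    perimeter. *)
Lemma haar_fluctuation2 (S : {set V}) (l : R) : 0 < l ->
  \sum_(eps : {ffun T -> bool}) `|\sum_Q (-1) ^+ eps Q * cell_gap S Q| <=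
  PT * ((l + K%:R ^+ 3 * (perimeter S)%:R / l) / 2).
Proof.
move=> l0.
have := @mean_abs_le2 R T bool (fun (Q : T) (b : bool) => (-1) ^+ b * cell_gap S Q)
  (K%:R ^+ 3 * (perimeter S)%:R) l.
rewrite card_bool -/PT; apply=> //.
  by move=> Q; rewrite big_bool/= expr0 expr1; lra.
apply: (@le_trans _ _ (2 * \sum_Q (K * K)%:R * `|cell_gap S Q|)).
  rewrite mulr_sumr; apply: ler_sum => Q _.
  rewrite [leLHS](_ : _ = 2 * cell_gap S Q ^+ 2); last first.
    by rewrite big_bool/= expr0 expr1; ring.
  rewrite ler_pM2l//.
  by rewrite -real_normK ?num_real// expr2; apply: ler_wpM2r => //; exact: cell_gap_le.
rewrite ler_pM2l// -mulr_sumr !exprS expr0 mulr1 natrM -!mulrA.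
by do 2 (apply: ler_wpM2l => //);
  exact: le_trans (sum_cell_gap_le S) (sum_gap_le_perimeter S).
Qed.

Definition tent (b : nat) : nat := minn b (K.-1 - b).
Definition height (x : V) : nat := minn (tent (x i0 %% K)) (tent (x i1 %% K)).
(** The sign pattern of the measure times a tent on each square.  The tents vanish
    on both sides of the border between two squares, hence changes of sign do
    not harm the Lipschitz constant. *)
Definition tent_function eps (x : V) : R :=
  (-1) ^+ eps (cell x) * (-1) ^+ odd (x i0 %/ K) * (height x)%:R.

Let K_gt0 : (0 < K)%N. Proof. by rewrite muln_gt0. Qed.

Lemma divmod_succ a :
  (a.+1 %/ K = a %/ K /\ a.+1 %% K = (a %% K).+1 \/
  a %% K = K.-1 /\ a.+1 %% K = 0)%N.
Proof.
have [dv|ndv] := boolP (K %| a.+1)%N; last by left; rewrite divnS// modnS (negbTE ndv).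
right; split; last by rewrite modnS dv.
have : (K %| (a %% K).+1)%N.
  have e : a.+1 = (a %/ K * K + (a %% K).+1)%N by rewrite addnS -divn_eq.
  by have := dvdn_addr (a %% K).+1 (dvdn_mull (a %/ K) (dvdnn K)); rewrite -e dv => <-.
move=> /(dvdn_leq (ltn0Sn _)); have := ltn_pmod a K_gt0.
by move: (a %% K)%N K => r k; lia.
Qed.

Lemma tent_end : tent K.-1 = 0%N.
Proof. by rewrite /tent subnn minn0. Qed.

Lemma tent_start : tent 0 = 0%N.
Proof. by rewrite /tent min0n. Qed.

Lemma tent_ge b : (h <= b)%N -> (b < 3 * h)%N -> (h <= tent b)%N.
Proof. by rewrite /tent /K leq_min => -> /= b3; move: b3 h_gt0; clear; lia. Qed.

Lemma height0 (x : V) i : tent (x i %% K) = 0%N -> height x = 0%N.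
Proof.
move=> xi; rewrite /height; have [e|ne] := eqVneq i i0; first by rewrite -e xi min0n.
have <- : i = i1 by apply: val_inj; case: i ne {xi} => -[|[|]].
by rewrite xi minn0.
Qed.

Lemma tent_function_lip eps (x : V) i (b : 'I_m) : b = (x i).+1 :> nat ->
  `|tent_function eps x - tent_function eps (upd i b x)| <= 1.
Proof.
move=> bx; set y := upd i b x.
have yi : y i = (x i).+1 :> nat by rewrite ffunE eqxx.
have [[dv md]|[xe ye]] := divmod_succ (x i); last first.
  rewrite /tent_function (@height0 x i) ?xe ?tent_end//.
  by rewrite (@height0 y i) ?yi ?ye ?tent_start// !mulr0 subrr normr0.
rewrite -yi in dv md.
have yk k : k != i -> y k = x k by move=> /negbTE ki; rewrite ffunE ki.
have same k : (y k %/ K = x k %/ K)%N.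
  by have [->//|/yk ->] := eqVneq k i.
have cells : cell y = cell x.
  by congr pair; apply: val_inj; rewrite /= same.
rewrite /tent_function cells same -mulrBr normrM normrM !normrX normrN1 !expr1n !mul1r.
have tents k : (tent (y k %% K) <= (tent (x k %% K)).+1)%N /\
    (tent (x k %% K) <= (tent (y k %% K)).+1)%N.
  have [->|/yk ->] := eqVneq k i; last by [].
  by rewrite md /tent; lia.
have [a1 a2] := tents i0; have [b1 b2] := tents i1.
have le1 : (height x <= (height y).+1)%N by rewrite /height; lia.
have le2 : (height y <= (height x).+1)%N by rewrite /height; lia.
rewrite ler_norml lerBlDr lerBrDr addrC.
move: le1 le2; rewrite -!(ler_nat R) -!natr1 => le1 le2.
by apply/andP; split; lra.
Qed.

Lemma haar_measure_tent eps :
  \sum_v (haar_measure eps v)%:~R * tent_function eps v =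
  \sum_(x in left_half) (2 * height x)%:R.
Proof.
rewrite haar_measureE; apply: eq_bigr => x xE; have xK := left_half_shift xE.
move: xE; rewrite inE => /andP[ev _].
have s0 := shift_coord xK; have s1 := shift_other K x.
have dv : (shift K x i0 %/ K = (x i0 %/ K).+1)%N.
  by rewrite s0 divnDr ?divnn ?K_gt0 ?addn1.
have cells : cell (shift K x) = cell x.
  congr pair; apply: val_inj; rewrite /= ?s1// dv !divn2 -[in LHS]uphalfE.
  by rewrite uphalf_half (negbTE ev).
have heights : height (shift K x) = height x by rewrite /height s0 s1 modnDr.
rewrite /tent_function cells heights dv /= (negbTE ev)/= expr0 expr1 mulr1 mulrN1 mulNr opprK.
rewrite -mulrDr mulrCA mulrA -expr2 sqrr_sign mul1r.
by rewrite natrM mulr_natl mulr2n.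
Qed.

(** The tents are at least [h] in the middle halves [h, 3h) of the cells, taken
    here only in the cells of even index; each coordinate then runs through at
    least [m / 8] values. *)
Lemma sum_height_ge : (2 * K <= m)%N ->
  (h * (m * m) <= \sum_(x in left_half) 64 * height x)%N.
Proof.
move=> Km.
pose A := [set a : 'I_m | [&& ~~ odd (a %/ K), (a + K < m)%N, (h <= a %% K)%N & (a %% K < 3 * h)%N]]%SET.
pose U := (m %/ (2 * K))%N.
have digits (u r : nat) : (r < 2 * h)%N ->
    ((u * (2 * K) + (h + r)) %/ K = 2 * u /\ (u * (2 * K) + (h + r)) %% K = h + r)%N.
  move=> rh; have hr : (h + r < K)%N by rewrite /K; lia.
  rewrite mulnA [(u * 2)%N]mulnC divnMDl// modnMDl.
  by rewrite (divn_small hr) (modn_small hr) addn0.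
have digit_lt (u r : nat) : (u < U)%N -> (r < 2 * h)%N ->
    (u * (2 * K) + (h + r) + K < m)%N.
  move=> uU rh; apply: leq_trans (leq_trunc_div m (2 * K)); rewrite -/U.
  apply: leq_trans (leq_mul uU (leqnn _)); rewrite mulSn /K; lia.
have digit_lt' u r uU rh := leq_ltn_trans (leq_addr K _) (digit_lt u r uU rh).
pose g (ur : 'I_U * 'I_(2 * h)) : 'I_m := Ordinal (digit_lt' _ _ (ltn_ord ur.1) (ltn_ord ur.2)).
have g_inj : injective g.
  move=> [u r] [u' r'] /(congr1 val)/= e.
  have [d1 d2] := digits u r (ltn_ord r); have [d1' d2'] := digits u' r' (ltn_ord r').
  congr pair; apply: val_inj => /=.
    by move: d1; rewrite e d1' => /eqP; rewrite eqn_pmul2l// => /eqP.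
  by move: d2; rewrite e d2' => /addnI.
have cardA : (m <= 8 * #|A|)%N.
  have UA : (U * (2 * h) <= #|A|)%N.
    have <- : #|{: 'I_U * 'I_(2 * h)}| = (U * (2 * h))%N by rewrite card_prod !card_ord.
    rewrite -(card_imset _ g_inj); apply: subset_leq_card.
    apply/fintype.subsetP => _ /imsetP[[u r] _ ->]; rewrite inE/=.
    have [-> ->] := digits u r (ltn_ord r).
    rewrite mul2n odd_double/= digit_lt//= leq_addr/=.
    by have := ltn_ord r; lia.
  have U0 : (0 < U)%N by rewrite divn_gt0 ?muln_gt0.
  have mU : (m < U.+1 * (2 * K))%N by rewrite -ltn_divLR ?muln_gt0.
  move: UA U0 mU; rewrite /K; nia.
have heightA (x : V) : x i0 \in A -> x i1 \in A -> (h <= height x)%N.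
  rewrite !inE => /and4P[_ _ a b] /and4P[_ _ c e].
  by rewrite /height leq_min !tent_ge.
pose pick (ab : 'I_m * 'I_m) : V := [ffun k : 'I_2 => if k == i0 then ab.1 else ab.2].
have pick_inj : injective pick.
  move=> [a b] [a' b'] /ffunP e; have := e i0; have := e i1.
  by rewrite !ffunE/= => -> ->.
have grid_le : (h * (m * m) <= \sum_(x in pick @: finset.setX A A) 64 * h)%N.
  rewrite sum_nat_const card_imset// cardsX; have := leq_mul cardA cardA.
  move: #|A| => a ma; rewrite (_ : a * a * (64 * h) = h * (8 * a * (8 * a)))%N; last lia.
  by rewrite leq_mul2l ma orbT.
apply: leq_trans grid_le _.
rewrite [leqLHS]big_mkcond [leqRHS]big_mkcond/=; apply: leq_sum => x _.
case: ifPn => // /imsetP[[a b] + xE]; rewrite finset.in_setX /= => /andP[aA bA].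
have x0 : x i0 = a by rewrite xE ffunE.
have x1 : x i1 = b by rewrite xE ffunE.
rewrite inE x0; move: (aA); rewrite inE => /and4P[-> -> _ _]/=.
by rewrite leq_mul2l/=; apply: heightA; rewrite ?x0 ?x1.
Qed.

End Plane.


(** * Dimension two *)
Section PlanarBound.
Variables (R : realType) (m : nat).
Let V := grid m 2.
Hypothesis m0 : (0 < m)%N.

Lemma planar_isoperimetric (S : {set V}) :
  (2 * #|S| <= m ^ 2)%N -> #|S|%:R <= 3 * (perimeter S)%:R ^+ 2 :> R.
Proof.
move=> S2; have [->|S0] := posnP #|S|; first by rewrite mulr_ge0 ?exprn_ge0.
have s0 : 0 < #|S|%:R :> R by rewrite ltr0n.
have [r r0 rS] := root_exists 1 s0.
have M0 : 0 < m%:R :> R by rewrite ltr0n.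
have y0 : 0 <= r^-1 by rewrite invr_ge0 ltW.
have yS : r^-1 ^+ 2 * #|S|%:R <= 1 by rewrite -rS exprVn mulVf// expf_neq0// gt_eqF.
have := isoperimetric m0 y0 yS.
have S2' : 2 * r ^+ 2 <= m%:R ^+ 2 by rewrite rS -natrX -natrM ler_nat.
rewrite -rS; set P := (perimeter S)%:R; set M := m%:R in M0 S2' *.
have rM : r / M <= 71 / 100.
  rewrite ler_pdivrMr// leNgt; apply/negP => lt.
  have : (71 / 100 * M) ^+ 2 <= r ^+ 2 by rewrite lerXn2r ?nnegrE ?(ltW lt)// ?mulr_ge0 ?ltW//.
  have : 0 < M ^+ 2 by rewrite exprn_gt0.
  by rewrite exprMn; lra.
have -> : 2 * r ^+ 2 * (r^-1 - M^-1) = 2 * r * (1 - r / M).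
  by field; rewrite !gt_eqF.
move=> iso.
have rP : 58 / 100 * r <= P.
  apply: le_trans iso; rewrite -subr_ge0.
  have -> : 2 * r * (1 - r / M) - 58 / 100 * r = r * (2 * (71 / 100 - r / M)) by field; rewrite gt_eqF.
  by rewrite mulr_ge0 ?(ltW r0)//; lra.
have : (58 / 100 * r) ^+ 2 <= P ^+ 2.
  by rewrite lerXn2r ?nnegrE ?mulr_ge0 ?(ltW r0)//; lra.
have : 0 <= r ^+ 2 by rewrite exprn_ge0 ?ltW.
by rewrite exprMn; lra.
Qed.


Lemma planar_scale_sum k p (P : R) : 0 <= P ->
  \sum_(a < k) 3 * P * (3 / 4) ^+ ndist a p <= 21 * P.
Proof.
move=> P0; rewrite -mulr_sumr.
have z0 : 0 <= 3 / 4 :> R by lra.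
have z1 : 3 / 4 < 1 :> R by lra.
have := geometric_two_sided k p z0 z1; set s := \sum_(_ < _) _ => hs.
have hs' : s <= 7.
  have e : (1 + 3 / 4) = 7 * (1 - 3 / 4) :> R by lra.
  by move: hs; rewrite e mulfK// gt_eqF// subr_gt0.
by have := ler_wpM2l P0 hs'; lra.
Qed.

(** Scales above the perimeter are bounded through the isoperimetric inequality,
    scales below it by the second moment with [l = K P (3/4)^(p-a)]. *)
Lemma planar_scale_term (a p : nat) (S : {set V}) :
  (2 * #|S| <= m ^ 2)%N -> (2 ^ p <= perimeter S < 2 ^ p.+1)%N ->
  \sum_(eps : {ffun 'I_m * 'I_m -> bool})
     `|\sum_v (haar_measure (2 ^ a) eps v)%:~R * (v \in S)%:R| <=
  2 ^+ #|{: 'I_m * 'I_m}| * (4 * 2 ^+ a) *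
    (3 * (perimeter S)%:R * (3 / 4) ^+ ndist a p) :> R.
Proof.
move=> S2 /andP[pP Pp].
have P0 : (0 < perimeter S)%N by apply: leq_trans pP; rewrite expn_gt0.
have h0 : (0 < 2 ^ a)%N by rewrite expn_gt0.
under eq_bigr do rewrite haar_measure_indicator.
pose P : R := (perimeter S)%:R; rewrite -/P.
set PT := 2 ^+ _; have PT0 : 0 <= PT by rewrite exprn_ge0.
have P0' : 0 < P by rewrite ltr0n.
have P1 : P <= 2 * 2 ^+ p by rewrite -exprS -natrX ler_nat ltnW.
have P2 : 2 ^+ p <= P by rewrite -natrX ler_nat.
rewrite -mulrA; have [pa|ap] := leqP p a.
  apply: le_trans (haar_fluctuation1 R (2 ^ a) S) _; apply: ler_wpM2l => //.
  have iso := planar_isoperimetric S2; rewrite -/P in iso.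
  have -> : ndist a p = (a - p)%N.
    by rewrite /ndist (_ : p - a = 0)%N ?addn0//; apply/eqP; rewrite subn_eq0.
  have e : 2 ^+ a = 2 ^+ p * 2 ^+ (a - p) :> R by rewrite -exprD subnKC.
  have g1 : 1 <= 2 ^+ (a - p) * (3 / 4) ^+ (a - p) :> R.
    by rewrite -exprMn exprn_ege1//; lra.
  apply: (@le_trans _ _ (6 * P ^+ 2)); first by lra.
  have PP : P ^+ 2 <= P * (2 * 2 ^+ p) by rewrite expr2; apply: ler_wpM2l => //; exact: ltW.
  apply: (@le_trans _ _ (12 * P * 2 ^+ p)); first by lra.
  have c0 : 0 <= 12 * P * 2 ^+ p by rewrite !mulr_ge0 ?exprn_ge0 ?(ltW P0').
  rewrite e; have := ler_wpM2l c0 g1.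
  move: (2 ^+ p) (2 ^+ (a - p)) ((3 / 4) ^+ (a - p)) => u v w; lra.
have -> : ndist a p = (p - a)%N.
  by rewrite /ndist (_ : a - p = 0)%N ?add0n//; apply/eqP; rewrite subn_eq0 ltnW.
set g := (3 / 4) ^+ (p - a).
have g0 : 0 < g by rewrite exprn_gt0//; lra.
pose K : R := (4 * 2 ^ a)%:R.
have KE : K = 4 * 2 ^+ a by rewrite /K natrM natrX.
have K0 : 0 < K by rewrite ltr0n muln_gt0.
have l0 : 0 < K * P * g by rewrite !mulr_gt0.
apply: le_trans (haar_fluctuation2 h0 S l0) _; apply: ler_wpM2l => //.
rewrite -/K -/P -KE.
have -> : K ^+ 3 * P / (K * P * g) = K * (K / g) by field; rewrite !gt_eqF.
have gg : 1 <= g * g * 2 ^+ (p - a).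
  by rewrite /g -!exprMn exprn_ege1//; lra.
have Kg : K / g <= 4 * (P * g).
  rewrite ler_pdivrMr//.
  have e : 2 ^+ p = 2 ^+ a * 2 ^+ (p - a) :> R by rewrite -exprD subnKC// ltnW.
  have c0 : 0 <= K by exact: ltW.
  apply: (@le_trans _ _ (K * (g * g * 2 ^+ (p - a)))).
    by have := ler_wpM2l c0 gg; rewrite mulr1.
  have c1 : 0 <= 4 * (g * g) by rewrite !mulr_ge0 ?(ltW g0).
  have := ler_wpM2l c1 P2; rewrite e KE.
  move: (2 ^+ a) (2 ^+ (p - a)) => u v; lra.
have := ler_wpM2l (ltW K0) Kg; lra.
Qed.

(** The squares of side [4 * 2^a] come in pairs that fit into the grid for
    [a < k = log2 m - 2]; grids too small for a single scale are covered by
    [C >= 1]. *)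
Theorem ln_card_le_of_dim2 (C : R) (F : TC R (@grid_graph m 2) -> L1_01 R) :
  1 <= C ->
  (forall mu nu : TC R (@grid_graph m 2),
    ((TC_norm (mu - nu))%:E <= L1_dist (F mu) (F nu))%E /\
    (L1_dist (F mu) (F nu) <= (C * TC_norm (mu - nu))%:E)%E) ->
  ln (m ^ 2)%:R <= 3 * 400 ^+ 2 * C.
Proof.
move=> C1 bilip.
have C0 : 0 <= C by apply: le_trans C1.
pose k := (trunc_log 2 m - 2)%N; pose M : R := m%:R.
have /andP[logm1 logm2] := @trunc_log_bounds 2 m isT m0.
have M0 : 0 < M by rewrite ltr0n.
pose T : finType := ('I_m * 'I_m)%type.
pose PT : R := 2 ^+ #|T|; have PT0 : 0 < PT by rewrite exprn_gt0.
pose K (a : nat) : R := 4 * 2 ^+ a.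
have K0 a : 0 < K a by rewrite mulr_gt0// exprn_gt0.
pose c (i : 'I_k * {ffun T -> bool}) : R := (PT * K i.1)^-1.
have PK0 a : 0 < PT * K a by rewrite mulr_gt0.
have c0 i : 0 <= c i by rewrite invr_ge0 ltW.
have p0 : 0 <= 21 :> R by lra.
have h0 a : (0 < 2 ^ a)%N by rewrite expn_gt0.
have sum_pair (f : 'I_k -> {ffun T -> bool} -> R) :
    \sum_i c i * f i.1 i.2 = \sum_(a < k) (PT * K a)^-1 * \sum_eps f a eps.
  under [RHS]eq_bigr do rewrite mulr_sumr.
  by rewrite (pair_bigA _ (fun (a : 'I_k) eps => (PT * K a)^-1 * f a eps)).
have poincare (S : {set V}) : (2 * #|S| <= m ^ 2)%N ->
    \sum_i c i * `|\sum_v (haar_measure (2 ^ i.1) i.2 v)%:~R * (v \in S)%:R| <=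
    21 * (perimeter S)%:R.
  move=> S2.
  rewrite (sum_pair (fun a eps => `|\sum_v (haar_measure (2 ^ a) eps v)%:~R * (v \in S)%:R|)).
  have [P0|P0] := posnP (perimeter S).
    have := planar_isoperimetric S2; rewrite P0 expr0n mulr0 lern0 cards_eq0 => /eqP ->.
    rewrite mulr0 big1// => a _; rewrite big1 ?mulr0// => eps _.
    by rewrite big1 ?normr0// => v _; rewrite inE mulr0.
  apply: le_trans (planar_scale_sum k (trunc_log 2 (perimeter S)) (ler0n _ _)).
  apply: ler_sum => a _; rewrite ler_pdivrMl//.
  by have := planar_scale_term a S2 (@trunc_log_bounds 2 _ isT P0).
have main := @grid_distortion_ge R m 2 m0 _ c (fun i => haar_measure (2 ^ i.1) i.2)
  (fun i x => tent_function R (2 ^ i.1) i.2 x) 21 C F c0 p0 C0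
  (fun i => haar_measure_balanced R (2 ^ i.1) i.2)
  (fun i x k b => @tent_function_lip R m (2 ^ i.1) (h0 _) i.2 x k b) poincare bilip.
have lower : k%:R * (M ^+ 2 / 128) <= \sum_i c i *
    (\sum_v (haar_measure (2 ^ i.1) i.2 v)%:~R * tent_function R (2 ^ i.1) i.2 v).
  rewrite (sum_pair (fun a eps =>
    \sum_v (haar_measure (2 ^ a) eps v)%:~R * tent_function R (2 ^ a) eps v)).
  rewrite mulr_natl -[X in _ *+ X]card_ord -sumr_const; apply: ler_sum => a _.
  under eq_bigr do rewrite haar_measure_tent//.
  have am : (2 * (4 * 2 ^ a) <= m)%N.
    rewrite mulnA (_ : 2 * 4 = 2 ^ 3)%N// -expnD; apply: leq_trans logm1.
    by rewrite leq_exp2l//; have := ltn_ord a; rewrite /k; lia.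
  have := sum_height_ge (h0 a) am; rewrite -(ler_nat R) !natrM natrX natr_sum => hh.
  rewrite sumr_const -[_ *+ #|_|]mulr_natl card_ffun card_bool natrX -/PT.
  rewrite ler_pdivlMl//.
  rewrite -mulrA; apply: ler_wpM2l; first exact: ltW.
  move: hh; under eq_bigr do rewrite natrM; rewrite -mulr_sumr.
  under [X in _ -> _ <= X]eq_bigr do rewrite natrM; rewrite -mulr_sumr.
  by rewrite -/M /K expr2; lra.
have kC : k%:R <= 21 * 256 * C.
  have := le_trans lower main; rewrite natrM natrX -/M.
  have M20 : 0 < M ^+ 2 by rewrite exprn_gt0.
  have -> : k%:R * (M ^+ 2 / 128) = k%:R / 128 * M ^+ 2 by ring.
  by rewrite [leRHS]mulrA ler_pM2r//; lra.
have lnM : ln M <= k%:R + 3.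
  have M2 : M <= 2 ^+ (k + 3).
    rewrite -natrX ler_nat; apply: ltnW; apply: leq_trans logm2 _.
    by rewrite leq_exp2l// /k; lia.
  apply: (@le_trans _ _ (ln (2 ^+ (k + 3) : R))); first by rewrite ler_ln ?posrE ?exprn_gt0.
  rewrite lnXn// -[ln 2 *+ _]mulr_natr natrD.
  have ln2 : ln (2 : R) <= 1.
    by have := @le_ln1Dx R 1; rewrite (_ : 1 + 1 = 2)//; apply.
  by rewrite -[leRHS]mul1r ler_wpM2r// addr_ge0.
rewrite natrX lnXn// -/M -[ln M *+ 2]mulr_natl.
have : 3 * (400 * 400) * 1 <= 3 * 400 ^+ 2 :> R by rewrite expr2; lra.
lra.
Qed.

End PlanarBound.

(** * Logarithmic distortion *)
Theorem theorem1p1 (R : realType) :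
  exists2 c : R, 0 < c &
  forall m d : nat, (1 <= m)%N -> (2 <= d)%N ->
  let N := #|grid m d| in
  [/\ N = (m ^ d)%N,
      c * ln N%:R = c * d%:R * ln m%:R &
      forall (C : R) (F : TC R (@grid_graph m d) -> L1_01 R),
        1 <= C ->
        (forall mu nu : TC R (@grid_graph m d),
          ((TC_norm (mu - nu))%:E <= L1_dist (F mu) (F nu))%E /\
          (L1_dist (F mu) (F nu) <= (C * TC_norm (mu - nu))%:E)%E) ->
        c * ln N%:R <= C].
Proof.
have k0 : 0 < 3 * 400 ^+ 2 :> R by apply: mulr_gt0; [exact: ltr0n|apply: exprn_gt0; exact: ltr0n].
exists (3 * 400 ^+ 2)^-1; first by rewrite invr_gt0.
move=> m d m1 d2 N; have NE : N = (m ^ d)%N by exact: card_grid.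
split=> // [|C F C1 bilip].
  by rewrite NE natrX lnXn ?ltr0n// -[ln _ *+ d]mulr_natl mulrA.
rewrite NE ler_pdivrMl//.
have C0 : 0 <= C by apply: le_trans C1.
have [m2|m2] := leqP 2 m; last first.
  have -> : m = 1%N by apply/eqP; rewrite eqn_leq m1 -ltnS m2.
  by rewrite exp1n ln1; apply: mulr_ge0; [exact: ltW k0|exact: C0].
have [d3|] := leqP 3 d; first exact: ln_card_le_of_dim_ge3 bilip.
rewrite ltnS => d2'; have dE : d = 2%N by apply/eqP; rewrite eqn_leq d2 d2'.
by move: F bilip; rewrite {}dE => F bilip; exact: ln_card_le_of_dim2 bilip.
Qed.
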